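(* Let $\Gamma$ be a metric graph, $v\in\Gamma$ and $A$ a nonempty subset of $\Gamma$. If every special open set $U$ with $v\in U$ satisfies $A\cap U\neq\emptyset$, then $v\in\mathcal L(A)$. Moreover, $\mathcal L(A)\supseteq\bigcap_{U\in\mathcal S_\Gamma,\,U\cap A=\emptyset}(\Gamma\setminus U)$. In addition, if every nonempty special open set on $\Gamma$ intersects $A$, then $A$ is a rank-determining set of $\Gamma$.
   Context: A metric graph $\Gamma$ is the geometric realization of a finite connected loopless multigraph with each edge identified with a closed interval of positive length. Divisors are elements of the free abelian group on the points of $\Gamma$; rational functions are continuous piecewise linear functions with integral slopes, $(f)=\sum_v\mathrm{ord}_vf\,(v)$ with $\mathrm{ord}_vf$ the sum of outgoing slopes at $v$; $D\sim D'$ iff $D-D'=(f)$; $|D|$ is the set of effective divisors linearly equivalent to $D$. $\mathrm{supp}\,D=\{v:D(v)\ne0\}$ and $\mathrm{supp}|D|=\bigcup_{D'\in|D|}\mathrm{supp}\,D'$. For nonempty $A\subseteq\Gamma$, $\mathcal L(A)$ is the set of $v\in\Gamma$ such that for every divisor $D$, $A\subseteq\mathrm{supp}|D|$ implies $v\in\mathrm{supp}|D|$. For a closed $X\subseteq\Gamma$ with finitely many components and $v\in\partial X$, $\mathrm{outdeg}_X(v)$ is the maximum number of internally disjoint segments of $\Gamma\setminus X$ with an open end at $v$. A special open set is a connected open $U\subseteq\Gamma$ such that $U=\emptyset$, or $U=\Gamma$, or every connected component $X$ of $\Gamma\setminus U$ contains a boundary point $v$ with $\mathrm{outdeg}_X(v)\ge2$;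 $\mathcal S_\Gamma$ is the set of special open sets. Rank: $r(D)=-1$ if $|D|=\emptyset$, otherwise $r(D)\ge s\ge0$ iff $|D-E|\ne\emptyset$ for all effective $E$ of degree $s$; $r_A(D)$ is the same with $E$ supported on $A$; $A$ is rank-determining if $r(D)=r_A(D)$ for all $D$. *)

(* Defs.v *)
From HB Require Import structures.
From mathcomp Require Import all_boot all_order all_algebra.
From mathcomp Require Import freeg.
From mathcomp Require Import all_classical all_reals all_analysis.
Import Order.TTheory GRing.Theory Num.Theory.
Import numFieldNormedType.Exports.

Set Implicit Arguments.
Unset Strict Implicit.
Unset Printing Implicit Defensive.

Local Open Scope classical_set_scope.
Local Open Scope ring_scope.

(* A model of a metric graph: a finite connected loopless multigraph with edge
   lengths. The orientation of the edges (mg_src to mg_tgt) only serves to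
   parametrize them. The graph with one vertex and no edge is allowed. *)
Record metric_graph (R : realType) := MetricGraph {
  mg_vertex : finType;
  mg_edge : finType;
  mg_src : mg_edge -> mg_vertex;
  mg_tgt : mg_edge -> mg_vertex;
  mg_len : mg_edge -> R;
  mg_len_gt0 : forall e, 0 < mg_len e;
  mg_loopless : forall e, mg_src e != mg_tgt e;
  mg_nonempty : (0 < #|mg_vertex|)%N;
  mg_connected : forall x y, connect
    (fun u w => [exists e, (mg_src e == u) && (mg_tgt e == w)
                        || (mg_src e == w) && (mg_tgt e == u)]) x y }.

(* The geometric realization: a point is either a vertex or a pair (e, t) of an
   edge e and a coordinate 0 < t < mg_len e in the interior of e. *)
Definition mg_point (R : realType) (G : metric_graph R) : Type :=
  (mg_vertex G + {x : mg_edge G * R | 0 < x.2 < mg_len x.1})%type.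

HB.instance Definition _ (R : realType) (G : metric_graph R) :=
  Choice.on (mg_point G).

Section MetricGraph.
Context {R : realType} {G : metric_graph R}.
Implicit Types (e : mg_edge G) (t : R) (U : set (mg_point G)).

(* The quotient map of the interval [0, mg_len e] onto the closed edge e,
   extended to R by constants. *)
Definition edge_pt e t : mg_point G :=
  match insub (e, t) with
  | Some y => inr y
  | None => inl (if t <= 0 then mg_src e else mg_tgt e)
  end.

(* The quotient topology. As edge_pt e is constant on each side of
   [0, mg_len e], openness of the preimage in R amounts to its openness relative
   to that interval. *)
Definition graph_open U : Prop := forall e, open (edge_pt e @^-1` U).

Lemma graph_openT : graph_open setT.
Proof. by move=> e; rewrite preimage_setT; exact: openT. Qed.

Lemma graph_openI : setI_closed graph_open.
Proof. by move=> U W oU oW e; rewrite preimage_setI; exact: openI. Qed.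

Lemma graph_open_bigU (I : Type) (F : I -> set (mg_point G)) :
  (forall i, graph_open (F i)) -> graph_open (\bigcup_i F i).
Proof.
by move=> oF e; rewrite preimage_bigcup; apply: bigcup_open => i _; exact: oF.
Qed.

End MetricGraph.

HB.instance Definition _ (R : realType) (G : metric_graph R) :=
  isOpenTopological.Build (mg_point G) (@graph_openT R G) (@graph_openI R G)
    (@graph_open_bigU R G).

Section Divisors.
Context {R : realType} {G : metric_graph R}.
Implicit Types (f : mg_point G -> R) (x : mg_point G) (A : set (mg_point G)).
Implicit Types (D E : {freeg (mg_point G)}) (d : mg_edge G * bool).

(* Continuous, and on each edge affine with integral slope on the pieces of a
   finite subdivision. *)
Definition rational_function f : Prop :=
  continuous f /\
  forall e, exists2 s : seq R, itv_partition 0 (mg_len e) s &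
    forall i, (i < size s)%N -> exists m : int,
      forall t, nth 0 (0 :: s) i <= t <= nth 0 s i ->
        f (edge_pt e t) =
          f (edge_pt e (nth 0 (0 :: s) i)) + m%:~R * (t - nth 0 (0 :: s) i).

(* Outgoing directions are pairs (e, b): along e with increasing coordinate if
   b is true, and with decreasing coordinate otherwise. *)
Definition outgoing x d : bool :=
  match x with
  | inl v => (if d.2 then mg_src d.1 else mg_tgt d.1) == v
  | inr y => (sval y).1 == d.1
  end.

(* The coordinate on the edge d.1 of a point x with outgoing direction d. *)
Definition edge_coord x d : R :=
  match x with
  | inl _ => if d.2 then 0 else mg_len d.1
  | inr y => (sval y).2
  end.

Definition ray x d (h : R) : mg_point G :=
  edge_pt d.1 (edge_coord x d + (if d.2 then h else - h)).

Definition slope f x d : R := lim ((f (ray x d h) - f x) / h @[h --> 0^'+]).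

(* For a rational function the value is an integer. *)
Definition ord f x : R := \sum_(d | outgoing x d) slope f x d.

(* D = (f) *)
Definition is_div f D : Prop := forall x, (coeff x D)%:~R = ord f x.

Definition lin_equiv D D' : Prop :=
  exists2 f, rational_function f & is_div f (D - D').

Definition effective D : Prop := forall x, 0 <= coeff x D.

Definition linear_system D : set {freeg (mg_point G)} :=
  [set D' | effective D' /\ lin_equiv D' D].

Definition supp D : set (mg_point G) := [set x | coeff x D != 0].

Definition supp_system D : set (mg_point G) :=
  \bigcup_(D' in linear_system D) supp D'.

(* The set written L(A). *)
Definition closureL A : set (mg_point G) :=
  [set v | forall D, A `<=` supp_system D -> supp_system D v].

(* For nonempty A the set of all s below is an initial segment of nat bounded by
   deg D, so that the supremum is the largest s. *)
Definition rank_on A D : \bar R :=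
  if `[< linear_system D = set0 >] then (-1)%:E
  else ereal_sup [set (s%:R : R)%:E | s in [set s : nat |
    forall E, effective E -> deg E = s%:Z -> supp E `<=` A ->
      linear_system (D - E) !=set0]].

Definition rank D : \bar R := rank_on setT D.

Definition rank_determining A : Prop := forall D, rank D = rank_on A D.

End Divisors.

Section SpecialOpen.
Context {R : realType} {G : metric_graph R}.
Implicit Types (v : mg_point G) (c : R -> mg_point G) (U X : set (mg_point G)).

Definition boundary X : set (mg_point G) := closure X `\` interior X.

Definition segment_from v c : Prop :=
  [/\ {within `[0, 1], continuous c}, {in `[0, 1] &, injective c} & c 0 = v].

(* Segments with an open end at v are given through their interiors
   c @` `]0, 1[, with c a segment from v. The number of disjoint ones is bounded
   by the valence of v, so that the supremum is a maximum. *)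
Definition outdeg X v : \bar R :=
  ereal_sup [set (n%:R : R)%:E | n in [set n : nat |
    exists c : 'I_n -> R -> mg_point G,
      [/\ forall i, segment_from v (c i),
          forall i, c i @` `]0, 1[ `<=` ~` X &
          trivIset setT (fun i => c i @` `]0, 1[)]]].

Definition special_open U : Prop :=
  [/\ open U, connected U &
      [\/ U = set0, U = setT |
          forall x, (~` U) x ->
            exists2 v, (connected_component (~` U) x `&`
                        boundary (connected_component (~` U) x)) v &
              (2%:E <= outdeg (connected_component (~` U) x) v)%E]].

End SpecialOpen.

(* Main.v *)
(* Replace D, for the point v outside supp|D|, by its v-reduced divisor: the D'
   in |D| such that every f with D' + (f) >= 0 attains its maximum at v. It is
   D + (F) for F the pointwise supremum of the f with D + (f) >= 0 and f(v) = 0;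
   the slopes of such f are bounded and f is convex on segments free of chips of
   D, so that F is there a maximum of finitely many lines with integral slopes
   and hence a rational function. Let U be the component of v in the complement
   of supp D'. Each f with D' + (f) >= 0 is constant on U, so U misses supp|D|.
   And U is special: if all boundary points of a component X of its complement
   had outdegree at most 1, then D' could fire X, i.e. there would be an f that
   is larger on X than at v. The claim on ranks follows by trading the
   points of E for points of A one at a time. *)

Require Import Defs.
From mathcomp Require Import all_boot all_order all_algebra.
From mathcomp Require Import freeg.
From mathcomp Require Import all_classical all_reals all_analysis.
From mathcomp Require Import ring lra.

Set Implicit Arguments.
Unset Strict Implicit.
Unset Printing Implicit Defensive.

Import Order.TTheory GRing.Theory Num.Theory.
Import numFieldNormedType.Exports.
Local Open Scope classical_set_scope.
Local Open Scope ring_scope.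

(** * Piecewise linear functions on the line *)

(** Subdivisions behave badly under sums, maxima and suprema, so piecewise linearity is handled
    through germs: an integral slope at each point in each direction. A subdivision is recovered
    only at the end, from the compactness of an edge. Integrality of slopes replaces limit arguments
    in three places. No slope can match a non-integral tilt, which makes local convexity global.
    Bounded slopes take finitely many values, so the supremum [F] is a maximum of finitely many
    lines near each point. A competitor falling short of [F] at a point by less than half of a small
    [h] has no larger slope there than [F], which carries [D + (f) >= 0] over to [F]. Maximality is
    over all competitors at once, so one function exceeding its value at [v] somewhere refutes it.
    Tents of slope 1 around the chips of X provide it: outdegree at most 1 means that a point pays
    at most one chip. *)

Section PiecewiseLinear.
Context {R : realType}.
Implicit Types (phi psi : R -> R) (a b c t h : R) (d : bool) (m p q j : int).

(** The right end [h = e] is included so that an inequality between germs can be evaluated at [e]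
    and divided by it. *)
Lemma near0P (P : R -> Prop) :
  (\forall h \near 0^'+, P h) <-> exists2 e, 0 < e & forall h, 0 < h <= e -> P h.
Proof.
split=> [|[e e0 Pe]].
  rewrite /at_right /= near_withinE => -[e /= e0 eP].
  exists (e / 2); first by rewrite divr_gt0.
  move=> h /andP[h0 he]; apply: eP => //=.
  by rewrite sub0r normrN gtr0_norm// (le_lt_trans he)// ltr_pdivrMr// ltr_pMr// ltr1n.
rewrite /at_right /= near_withinE; exists e => //= h.
by rewrite /ball/= sub0r normrN => /ltW he h0; apply: Pe; rewrite h0 -(gtr0_norm h0).
Qed.

Lemma near0_lt e : 0 < e -> \forall h \near (0 : R)^'+, 0 < h < e.
Proof.
move=> e0; apply/near0P; exists (e / 2); first by rewrite divr_gt0.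
by move=> h /andP[-> he]; rewrite (le_lt_trans he)// ltr_pdivrMr// ltr_pMr// ltr1n.
Qed.

(** [m] is the outgoing slope: for [d = false] it is minus the left derivative. Hence a kink is
    convex exactly when its two slopes have a sum [>= 0], and inside an edge this sum is the
    order. *)
Definition germ phi t d m :=
  \forall h \near 0^'+, phi (t + (if d then h else - h)) = phi t + m%:~R * h.

Definition pl phi := forall t d, exists m, germ phi t d m.

Lemma germ_lim phi t d m : germ phi t d m ->
  lim ((phi (t + (if d then h else - h)) - phi t) / h @[h --> 0^'+]) = m%:~R.
Proof.
move=> g; apply: lim_near_cst => //; near=> h.
have -> : phi (t + (if d then h else - h)) = phi t + m%:~R * h by near: h.
by rewrite addrC addKr mulfK// gt_eqF.
Unshelve. all: by end_near. Qed.

Lemma germ_cst c t d : germ (fun=> c) t d 0.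
Proof. by near=> h; rewrite mul0r addr0. Unshelve. all: by end_near. Qed.

Lemma germD phi psi t d m p : germ phi t d m -> germ psi t d p ->
  germ (fun x => phi x + psi x) t d (m + p).
Proof.
move=> gm gp; apply: filterS2 gm gp => h -> ->.
by rewrite intrD mulrDl addrACA.
Qed.

Lemma germN phi t d m : germ phi t d m -> germ (fun x => - phi x) t d (- m).
Proof.
by move=> gm; apply: filterS gm => h ->; rewrite opprD mulrNz mulNr.
Qed.

(** At a tie the larger slope wins; otherwise the larger function stays on top while [h] times the
    difference of slopes is below the gap. *)
Lemma germ_max phi psi t d m p : germ phi t d m -> germ psi t d p ->
  exists q, germ (fun x => Num.max (phi x) (psi x)) t d q.
Proof.
wlog le : phi psi m p / phi t <= psi t.
  move=> W gm gp; have [le|/ltW le] := lerP (phi t) (psi t); first exact: W le gm gp.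
  have [q gq] := W _ _ _ _ le gp gm; exists q; apply: filterS gq => h.
  by rewrite !(maxC (psi _)).
move=> gm gp; have [eq|neq] := eqVneq (phi t) (psi t).
  exists (Num.max m p); rewrite /germ.
  near=> h; have h0 : 0 < h by [].
  have -> : phi (t + (if d then h else - h)) = phi t + m%:~R * h by near: h.
  have -> : psi (t + (if d then h else - h)) = psi t + p%:~R * h by near: h.
  rewrite eq maxxx; have [mp|/ltW mp] := lerP m p.
    by apply/max_idPr; rewrite lerD2l ler_pM2r// ler_int.
  by apply/max_idPl; rewrite lerD2l ler_pM2r// ler_int.
exists p; rewrite /germ.
have C0 : 0 < `|m%:~R - p%:~R| + 1 :> R by rewrite ltr_pwDr.
have lt : 0 < psi t - phi t by rewrite subr_gt0 lt_neqAle neq.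
near=> h.
have -> : phi (t + (if d then h else - h)) = phi t + m%:~R * h by near: h.
have -> : psi (t + (if d then h else - h)) = psi t + p%:~R * h by near: h.
have h0 : 0 < h by [].
have hh : 0 < h < (psi t - phi t) / (`|m%:~R - p%:~R| + 1).
  by near: h; apply: near0_lt; exact: divr_gt0.
case/andP: hh => _; rewrite ltr_pdivlMr// => hh.
rewrite (max_idPr le); apply/max_idPr.
have := ler_norm (m%:~R - p%:~R : R); nra.
Unshelve. all: by end_near. Qed.

Lemma pl_cst c : pl (fun=> c).
Proof. by move=> t d; exists 0; exact: germ_cst. Qed.

Lemma plD phi psi : pl phi -> pl psi -> pl (fun x => phi x + psi x).
Proof.
by move=> P Q t d; have [m gm] := P t d; have [p gp] := Q t d; exists (m + p); exact: germD.
Qed.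

Lemma plN phi : pl phi -> pl (fun x => - phi x).
Proof. by move=> P t d; have [m gm] := P t d; exists (- m); exact: germN. Qed.

Lemma pl_max phi psi : pl phi -> pl psi -> pl (fun x => Num.max (phi x) (psi x)).
Proof.
by move=> P Q t d; have [m gm] := P t d; have [p gp] := Q t d; exact: germ_max gm gp.
Qed.

Lemma germ_opp phi t d m : germ phi t d m -> germ (phi \o -%R) (- t) (~~ d) m.
Proof.
apply: filterS => h /=; rewrite opprK => <-; congr (phi _).
by case: d; rewrite /= opprD !opprK.
Qed.

Lemma pl_opp phi : pl phi -> pl (phi \o -%R).
Proof.
move=> P t d; have [m /germ_opp] := P (- t) (~~ d).
by rewrite opprK negbK; exists m.
Qed.

Lemma pl_continuous phi : pl phi -> continuous phi.
Proof.
move=> P t; apply/cvgrPdist_lt => /= e e0.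
have [m /near0P[u u0 Hu]] := P t true; have [p /near0P[w w0 Hw]] := P t false.
pose C : R := `|m%:~R| + `|p%:~R| + 1.
have C0 : 0 < C by rewrite ltr_pwDr.
pose r := Num.min (e / C) (Num.min u w).
have r0 : 0 < r by rewrite /r !lt_min divr_gt0// u0.
exists r => //= s; rewrite /ball_/= /r !lt_min ltr_pdivlMr// => /and3P[sC su sw].
have [st|st|->] := ltgtP s t; last by rewrite subrr normr0.
  have k0 : 0 < t - s by rewrite subr_gt0.
  move: sC su sw; rewrite gtr0_norm// => sC su sw.
  have := Hw (t - s); rewrite k0 (ltW sw) opprB addrC subrK => -> //.
  rewrite opprD addNKr normrN normrM (gtr0_norm k0) (le_lt_trans _ sC)//.
  by rewrite mulrC ler_pM2l// /C -addrA [leRHS]addrCA lerDl addr_ge0.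
have k0 : 0 < s - t by rewrite subr_gt0.
move: sC su sw; rewrite distrC gtr0_norm// => sC su sw.
have := Hu (s - t); rewrite k0 (ltW su) addrC subrK => -> //.
rewrite opprD addNKr normrN normrM (gtr0_norm k0) (le_lt_trans _ sC)//.
by rewrite mulrC ler_pM2l// /C -addrA lerDl addr_ge0.
Qed.

Lemma germ_at_max phi c t d m :
  (\forall h \near 0^'+,
    phi (t + (if d then h else - h)) - c * (if d then h else - h) <= phi t) ->
  germ phi t d m -> m%:~R <= if d then c else - c.
Proof.
move=> mx g; have [e e0 H] := (near0P _).1 (filterI mx g).
have [] := H e; first by rewrite e0 lexx.
move=> + E; rewrite E => {mx g H E} K; rewrite -(ler_pM2r e0).
by case: d K => /= K; lra.
Qed.

End PiecewiseLinear.

Section PiecewiseLinearGlobal.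
Context {R : realType}.
Implicit Types (phi psi : R -> R) (a b c t h : R) (d : bool) (m p q j : int).

Lemma germ_interior_max phi c a b t d m : pl phi ->
  a <= t <= b -> (if d then t < b else a < t) ->
  (forall s, a <= s <= b -> phi s - c * s <= phi t - c * t) ->
  germ phi t d m -> m%:~R <= if d then c else - c.
Proof.
move=> P /andP[at_ tb] ltd mx; apply: germ_at_max.
have e0 : 0 < if d then b - t else t - a by case: d ltd => ?; rewrite subr_gt0.
near=> h.
have /andP[h0 he] : 0 < h < if d then b - t else t - a by near: h; exact: near0_lt.
have := mx (t + if d then h else - h); move: he; case: (d) => he H; lra.
Unshelve. all: by end_near. Qed.

Lemma pl_tilt_max phi c a b : pl phi -> a <= b ->
  exists2 t, a <= t <= b & forall s, a <= s <= b -> phi s - c * s <= phi t - c * t.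
Proof.
move=> P ab.
have C : {within `[a, b], continuous (fun s => phi s - c * s)}.
  apply: continuous_subspaceT => x; apply: cvgB; first exact: pl_continuous.
  by apply: cvgM; [exact: cvg_cst | exact: cvg_id].
have [t] := EVT_max ab C; rewrite in_itv /= => tab mx; by exists t.
Qed.

(* Otherwise tilt phi by a non-integral slope strictly between that of the chord
   and j: the tilted function has an interior maximum, where the two slopes of
   phi would have to be opposite and equal to the tilt. *)
Lemma convex_germ_le phi a b j : pl phi ->
  (forall t p q, a < t < b -> germ phi t true p -> germ phi t false q -> 0 <= p + q) ->
  germ phi a true j -> forall t, a <= t <= b -> phi a + j%:~R * (t - a) <= phi t.
Proof.
move=> P cvx gj t1 /andP[]; rewrite le_eqVlt => /predU1P[<- _|at1 t1b].
  by rewrite subrr mulr0 addr0.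
rewrite leNgt; apply/negP => lt.
pose s := (phi t1 - phi a) / (t1 - a).
have t1a : 0 < t1 - a by rewrite subr_gt0.
have sj : s < j%:~R by rewrite ltr_pdivrMr// ltrBlDl.
pose l := (Num.max s (j%:~R - 1) + j%:~R) / 2.
have [sl jl lj] : [/\ s < l, j%:~R - 1 < l & l < j%:~R].
  have H1 : s <= Num.max s (j%:~R - 1) by rewrite le_max lexx.
  have H2 : j%:~R - 1 <= Num.max s (j%:~R - 1) by rewrite le_max lexx orbT.
  have H3 : Num.max s (j%:~R - 1) < j%:~R by rewrite gt_max sj/= ltrBlDr ltrDl.
  by rewrite /l; split; lra.
have [c cab mx] := pl_tilt_max l P (ltW at1).
have ac : a < c.
  rewrite lt_neqAle (andP cab).1 andbT; apply/eqP => ac.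
  move: cab mx; rewrite -ac => cab mx.
  by have := @germ_interior_max phi l a t1 a true j P cab at1 mx gj; rewrite leNgt lj.
have ct1 : c < t1.
  rewrite lt_neqAle (andP cab).2 andbT; apply/eqP => ct1.
  have := mx a; rewrite lexx (ltW at1) ct1 => /(_ isT).
  have : s * (t1 - a) = phi t1 - phi a by rewrite divfK// gt_eqF.
  have : s * (t1 - a) < l * (t1 - a) by rewrite ltr_pM2r.
  lra.
have [p gp] := P c true; have [q gq] := P c false.
have pl := @germ_interior_max phi l a t1 c true p P cab ct1 mx gp.
have ql := @germ_interior_max phi l a t1 c false q P cab ac mx gq.
have : a < c < b by rewrite ac (lt_le_trans ct1).
move=> /(cvx _ _ _)/(_ gp gq); rewrite -(ler_int R) intrD => pq.
have : j - 1 < p /\ p < j.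
  by rewrite -!(ltr_int R) intrB; split; lra.
by case; rewrite ltrBlDr ltzD1 leNgt => /negP.
Qed.

(** A mean value inequality: after a tilt by [M + 1] the maximum cannot lie at [t > a], where the
    slope backwards would be at most [- (M + 1)]. The extra 1 makes the contradiction strict and is
    harmless in a mere bound. *)
Lemma pl_le_slope phi (M : R) a b : pl phi -> a <= b ->
  (forall t q, a < t <= b -> germ phi t false q -> - M <= q%:~R) ->
  phi b <= phi a + (M + 1) * (b - a).
Proof.
move=> P ab H; have [c cab mx] := pl_tilt_max (M + 1) P ab.
have [ac|ac] := ltP a c.
  have [q gq] := P c false.
  have := @germ_interior_max phi (M + 1) a b c false q P cab ac mx gq.
  have := H c q; rewrite ac (andP cab).2 => /(_ isT gq); lra.
have {}ac : c = a by apply/eqP; rewrite eq_le ac (andP cab).1.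
have := mx b; rewrite ab lexx ac => /(_ isT); lra.
Qed.

(** Near [t] only the lines with value [phi t] at [h = 0] compete, and the one of largest slope
    wins. The line attaining the value may depend on [h] in the hypothesis. *)
Lemma germ_max_lines (I : finType) phi t d (A : I -> R) (j : I -> int) (e : R) :
  0 < e ->
  (forall i h, 0 <= h <= e -> A i + (j i)%:~R * h <= phi (t + (if d then h else - h))) ->
  (forall h, 0 <= h <= e ->
    exists i, phi (t + (if d then h else - h)) <= A i + (j i)%:~R * h) ->
  exists m, germ phi t d m.
Proof.
move=> e0 lo up.
have h0 : 0 <= (0 : R) <= e by rewrite lexx ltW.
have phi0 : phi (t + (if d then 0 else - 0)) = phi t by case: d {lo up}; rewrite ?oppr0 addr0.
have Ale i : A i <= phi t by have := lo i 0 h0; rewrite phi0 mulr0 addr0.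
have [i0] := up 0 h0; rewrite phi0 mulr0 addr0 => Ai0.
have {}Ai0 : A i0 == phi t by rewrite eq_le Ale Ai0.
have [i /eqP Ai imax] := @Order.TotalTheory.arg_maxP _ _ _ i0 (fun i => A i == phi t) j Ai0.
exists (j i).
have H : \forall h \near (0 : R)^'+, forall k, A k + (j k)%:~R * h <= A i + (j i)%:~R * h.
  apply: filter_forall => k.
  have [/imax jk|neq] := boolP (A k == phi t).
    by near=> h; apply: lerD; rewrite ?Ai// ler_pM2r// ler_int.
  have C0 : 0 < `|(j k)%:~R - (j i)%:~R| + 1 :> R by rewrite ltr_pwDr.
  have lt : 0 < A i - A k by rewrite subr_gt0 lt_neqAle Ai neq Ale.
  near=> h.
  have /andP[hp] : 0 < h < (A i - A k) / (`|(j k)%:~R - (j i)%:~R| + 1).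
    by near: h; apply: near0_lt; exact: divr_gt0.
  rewrite ltr_pdivlMr// => hh.
  have := ler_norm ((j k)%:~R - (j i)%:~R : R); nra.
near=> h.
have /andP[hp he] : 0 < h < e by near: h; exact: near0_lt.
have hh : 0 <= h <= e by rewrite !ltW.
have Hk : forall k, A k + (j k)%:~R * h <= A i + (j i)%:~R * h by near: h.
apply/eqP; rewrite eq_le -Ai lo// andbT.
by have [k /le_trans] := up h hh; apply.
Unshelve. all: by end_near. Qed.

(** The subdivision clause of [rational_function], for a function along one edge. *)
Definition affine_pieces phi a (s : seq R) := forall i, (i < size s)%N ->
  exists m : int, forall t, nth 0 (a :: s) i <= t <= nth 0 s i ->
    phi t = phi (nth 0 (a :: s) i) + m%:~R * (t - nth 0 (a :: s) i).

Lemma affine_pieces_cons phi a x (s : seq R) : affine_pieces phi a (x :: s) <->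
  (exists m : int, forall t, a <= t <= x -> phi t = phi a + m%:~R * (t - a)) /\
  affine_pieces phi x s.
Proof.
split=> [H|[H0 H] [|i]//]; last by rewrite ltnS => /H.
by split=> [|i si]; [exact: (H 0%N) | exact: (H i.+1)].
Qed.

Lemma affine_pieces_cat phi a (s1 s2 : seq R) :
  affine_pieces phi a s1 -> affine_pieces phi (last a s1) s2 -> affine_pieces phi a (s1 ++ s2).
Proof.
elim: s1 a => //= x s1 IH a /affine_pieces_cons[H1 H2] H3.
by apply/affine_pieces_cons; split=> //; exact: IH.
Qed.

Lemma germ_affine_piece phi a x m : (forall t, a <= t <= x -> phi t = phi a + m%:~R * (t - a)) ->
  (forall t, a <= t < x -> germ phi t true m) /\ (forall t, a < t <= x -> germ phi t false (- m)).
Proof.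
move=> H; split=> t /andP[at_ tx].
  have e0 : 0 < x - t by rewrite subr_gt0.
  near=> h; have /andP[h0 hx] : 0 < h < x - t by near: h; exact: near0_lt.
  by rewrite (H (t + h)) ?(H t); [ring | apply/andP; split; lra | apply/andP; split; lra].
have e0 : 0 < t - a by rewrite subr_gt0.
near=> h; have /andP[h0 hx] : 0 < h < t - a by near: h; exact: near0_lt.
by rewrite (H (t - h)) ?(H t) ?mulrNz; [ring | apply/andP; split; lra | apply/andP; split; lra].
Unshelve. all: by end_near. Qed.

(** The third claim makes the order vanish off the subdivision points, so that a function has a
    divisor with finite support. *)
Lemma germ_affine_pieces phi a b (s : seq R) :
  itv_partition a b s -> affine_pieces phi a s ->
  [/\ forall t, a <= t < b -> exists m, germ phi t true m,
      forall t, a < t <= b -> exists m, germ phi t false m &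
      forall t, a < t < b -> t \notin s ->
        exists2 m, germ phi t true m & germ phi t false (- m)].
Proof.
elim: s a => [|x s IH] a [pa la] H.
  move: la => /eqP /= <-; split=> t.
  - by move=> /andP[/le_lt_trans H1 /H1]; rewrite ltxx.
  - by move=> /andP[/lt_le_trans H1 /H1]; rewrite ltxx.
  - by move=> /andP[/lt_trans H1 /H1]; rewrite ltxx.
move: pa => /= /andP[ax px].
have /affine_pieces_cons[[m /germ_affine_piece[g1 g2]] H2] := H.
have [|I1 I2 I3] := IH x _ H2; first by split.
split=> t /andP[at_ tb].
- have [tx|xt] := ltP t x; first by exists m; apply: g1; rewrite at_.
  by apply: I1; rewrite xt.
- have [tx|xt] := leP t x; first by exists (- m); apply: g2; rewrite at_.
  by apply: I2; rewrite xt.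
rewrite inE negb_or => /andP[tnx ts].
have [tx|xt|E] := ltgtP t x; last by rewrite E eqxx in tnx.
  by exists m; [apply: g1; rewrite (ltW at_) | apply: g2; rewrite at_ ltW].
by apply: I3 => //; rewrite xt.
Qed.

(** Compactness through a supremum: let [S] be the set of points up to which a subdivision exists.
    The left germ at [sup S] puts [sup S] into [S], and the right germ would lead beyond it if it
    were less than [b]. *)
Lemma pl_affine_pieces phi a b : pl phi -> a < b ->
  exists2 s, itv_partition a b s & affine_pieces phi a s.
Proof.
move=> P ab.
pose S := [set t | a <= t <= b /\ exists2 s, itv_partition a t s & affine_pieces phi a s].
have ext t u : S t -> t < u <= b ->
    (exists m : int, forall r, t <= r <= u -> phi r = phi t + m%:~R * (r - t)) -> S u.
  move=> [/andP[at_ _] [s [ps /eqP ls] As]] /andP[tu ub] L; split.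
    by rewrite ub (le_trans at_ (ltW tu)).
  exists (s ++ [:: u]).
    by split; rewrite ?last_cat ?ls//= cat_path ps ls /= tu.
  apply: affine_pieces_cat => //; rewrite ls; apply/affine_pieces_cons; split=> //.
have Sa : S a.
  by split; [rewrite lexx ltW | exists [::] => //; split => //=].
have ubS : has_ubound S by exists b => t [/andP[]].
have supS : has_sup S by split; [exists a | ].
have aS : a <= sup S by exact: ub_le_sup.
have Sb : sup S <= b by apply: ge_sup; [exists a | move=> t [/andP[]]].
have SS : S (sup S).
  have [q /near0P[e e0 He]] := P (sup S) false.
  have [t St lt] := sup_adherent e0 supS.
  have : t <= sup S by exact: ub_le_sup.
  rewrite le_eqVlt => /predU1P[<-//|ts]; apply: (ext t); rewrite ?ts//.
  have Ht r : t <= r -> r <= sup S -> phi r = phi (sup S) + q%:~R * (sup S - r).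
    move=> tr; rewrite le_eqVlt => /predU1P[->|rS]; first by rewrite subrr mulr0 addr0.
    have := He (sup S - r); rewrite subKr; apply.
    by apply/andP; split; lra.
  exists (- q) => r /andP[tr rs]; rewrite (Ht r)// (Ht t)// ?ltW// mulrNz; ring.
have [E|lt] := eqVneq (sup S) b; first by case: SS => _; rewrite E.
have {}lt : sup S < b by rewrite lt_neqAle lt.
have [p /near0P[e e0 He]] := P (sup S) true.
pose u := Num.min (sup S + e) b.
have Su : sup S < u by rewrite lt_min lt andbT ltrDl.
have : S u.
  apply: (ext (sup S)) => //; first by rewrite Su ge_min lexx orbT.
  exists p => r /andP[]; rewrite le_eqVlt => /predU1P[<- _|Sr]; first by rewrite subrr mulr0 addr0.
  rewrite le_min => /andP[re _].
  have := He (r - sup S); rewrite [sup S + _]addrC subrK => -> //.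
  by apply/andP; split; lra.
by move=> /(ub_le_sup ubS); rewrite leNgt Su.
Qed.

Lemma exists_min_pos (L : R) (s : seq R) : 0 < L ->
  exists2 l, 0 < l <= L & (l = L \/ l \in s) /\ forall r, r \in s -> 0 < r -> l <= r.
Proof.
move=> L0; elim: s => [|x s [l /andP[l0 lL] [ls lmin]]].
  by exists L; [rewrite L0 lexx | split; [left | ]].
have [/andP[x0 xl]|H] := boolP (0 < x < l).
  exists x; first by rewrite x0 (le_trans (ltW xl)).
  split; first by right; rewrite mem_head.
  move=> r; rewrite inE => /predU1P[->//|rs r0].
  by rewrite (le_trans (ltW xl))// lmin.
exists l; first by rewrite l0.
split; first by case: ls => [->|ls]; [left | right; rewrite inE ls orbT].
move=> r; rewrite inE => /predU1P[->|]; last exact: lmin.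
by move: H; rewrite negb_and => /orP[/negP|]; rewrite -?leNgt.
Qed.

End PiecewiseLinearGlobal.

(** * Edges, germs and orders *)

Section EdgeGerms.
Context {R : realType} {G : metric_graph R}.
Implicit Types (e : mg_edge G) (t h : R) (x y : mg_point G) (D : {freeg (mg_point G)}).
Implicit Types (f g : mg_point G -> R) (d : mg_edge G * bool) (m p q : int).

Lemma edge_pt_src e t : t <= 0 -> edge_pt e t = inl (mg_src e).
Proof. by move=> t0; rewrite /edge_pt insubN ?t0//= ltNge t0. Qed.

Lemma edge_pt_tgt e t : mg_len e <= t -> edge_pt e t = inl (mg_tgt e).
Proof.
move=> tl; rewrite /edge_pt insubN /=; last by rewrite (ltNge t) tl andbF.
by rewrite leNgt (lt_le_trans (mg_len_gt0 e)).
Qed.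

Lemma edge_pt_inr e t (te : 0 < (e, t).2 < mg_len (e, t).1) :
  edge_pt e t = inr (exist _ (e, t) te).
Proof. by rewrite /edge_pt (insubT (fun x : mg_edge G * R => 0 < x.2 < mg_len x.1) te). Qed.

Lemma edge_ptE e t : 0 < t < mg_len e ->
  exists2 y : {x : mg_edge G * R | 0 < x.2 < mg_len x.1}, edge_pt e t = inr y & sval y = (e, t).
Proof. by move=> te; exists (exist _ (e, t) te) => //; exact: edge_pt_inr. Qed.

Lemma edge_pt_inj e e' t t' : 0 < t < mg_len e -> edge_pt e t = edge_pt e' t' ->
  e = e' /\ t = t'.
Proof.
move=> /edge_ptE[y -> Ey].
have [t0|t0] := leP t' 0; first by rewrite edge_pt_src.
have [tl|tl] := leP (mg_len e') t'; first by rewrite edge_pt_tgt.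
have /edge_ptE[y' -> Ey'] : 0 < t' < mg_len e' by rewrite t0.
by case=> E; move: Ey; rewrite E Ey' => -[].
Qed.

Lemma edge_pt_coord x d : outgoing x d -> edge_pt d.1 (edge_coord x d) = x.
Proof.
case: d => e b; case: x => [v|y] /=.
  by case: b => /eqP <-; [rewrite edge_pt_src | rewrite edge_pt_tgt].
by case: y => -[e' t] te /= /eqP <-; rewrite edge_pt_inr.
Qed.

Lemma edge_pt_out e t b : (if b then 0 <= t < mg_len e else 0 < t <= mg_len e) ->
  outgoing (edge_pt e t) (e, b) /\ edge_coord (edge_pt e t) (e, b) = t.
Proof.
move=> H.
have [t0|t0] := leP t 0.
  rewrite edge_pt_src//; case: b H => /andP[H1 H2] /=; first by split=> //; apply/eqP;
    rewrite eq_le H1.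
  by rewrite leNgt H1 in t0.
have [tl|tl] := leP (mg_len e) t.
  rewrite edge_pt_tgt//; case: b H => /andP[H1 H2] /=; first by rewrite leNgt H2 in tl.
  by split=> //; apply/eqP; rewrite eq_le H2 tl.
by have /edge_ptE[y -> Ey] : 0 < t < mg_len e by [rewrite t0]; rewrite /= Ey.
Qed.

Lemma edge_coord_room x d : outgoing x d ->
  0 < (if d.2 then mg_len d.1 - edge_coord x d else edge_coord x d) <= mg_len d.1.
Proof.
case: d => e b; case: x => [v|[[e' t] /= /andP[t0 tl]]] /=.
  by case: b; rewrite ?subr0 lexx mg_len_gt0.
by move=> /eqP <-; case: b; rewrite ?subr_gt0 ?tl ?t0 ?(ltW tl)// lerBlDr lerDl ltW.
Qed.

Lemma edge_coord_itv x d : outgoing x d -> 0 <= edge_coord x d <= mg_len d.1.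
Proof.
move=> /edge_coord_room; case: (d.2) => /andP[H1 H2]; apply/andP; split; lra.
Qed.

Lemma ray0 x d : outgoing x d -> ray x d 0 = x.
Proof. by move=> xd; rewrite /ray oppr0 if_same addr0 edge_pt_coord. Qed.

Definition dgerm f x d m := germ (f \o edge_pt d.1) (edge_coord x d) d.2 m.

Lemma dgermP f x d m : outgoing x d ->
  dgerm f x d m <-> \forall h \near 0^'+, f (ray x d h) = f x + m%:~R * h.
Proof. by move=> xd; rewrite /dgerm /germ /= edge_pt_coord. Qed.

Lemma slope_dgerm f x d m : outgoing x d -> dgerm f x d m -> slope f x d = m%:~R.
Proof. by move=> xd /germ_lim <-; rewrite /= edge_pt_coord. Qed.

(** The local form of [rational_function]. Since [edge_pt e] is constant beyond both ends, germs on
    all of R ask no more than germs on the closed edge. *)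
Definition gpl f := forall e, pl (f \o edge_pt e).

Lemma gpl_dgerm f x d : gpl f -> exists m, dgerm f x d m.
Proof. by move=> /(_ d.1 (edge_coord x d) d.2). Qed.

Lemma gpl_slope f x d : gpl f -> outgoing x d ->
  exists2 m, dgerm f x d m & slope f x d = m%:~R.
Proof.
by move=> fpl xd; have [m gm] := gpl_dgerm x d fpl; exists m => //; exact: slope_dgerm.
Qed.

Lemma gpl_cst (c : R) : gpl (fun=> c).
Proof. by move=> e; exact: pl_cst. Qed.

Lemma gplD f g : gpl f -> gpl g -> gpl (fun x => f x + g x).
Proof. by move=> F H e; exact: (plD (F e) (H e)). Qed.

Lemma gplN f : gpl f -> gpl (fun x => - f x).
Proof. by move=> F e; exact: (plN (F e)). Qed.

(** A direction at a real parameter may run outside the closed edge; nothing changes there, so only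
    outgoing directions need be examined. *)
Lemma edge_pt_dir e t (b : bool) :
  (outgoing (edge_pt e t) (e, b) /\ edge_coord (edge_pt e t) (e, b) = t) \/
  \forall h \near 0^'+, edge_pt e (t + (if b then h else - h)) = edge_pt e t.
Proof.
have [tb|tb] := boolP (if b then 0 <= t < mg_len e else 0 < t <= mg_len e).
  by left; exact: edge_pt_out.
right; suff : exists2 r, 0 < r & forall h, 0 < h < r ->
    edge_pt e (t + (if b then h else - h)) = edge_pt e t.
  by move=> [r r0 H0]; near=> h; apply: H0; near: h; exact: near0_lt.
move: tb; case: b => /=; rewrite negb_and -?leNgt -?ltNge => /orP[H0|H0].
- exists (- t) => [|h /andP[h0 ht]]; first by rewrite oppr_gt0.
  by rewrite !edge_pt_src//; lra.
- by exists 1 => // h /andP[h0 _]; rewrite !edge_pt_tgt//; lra.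
- by exists 1 => // h /andP[h0 _]; rewrite !edge_pt_src//; lra.
- exists (t - mg_len e) => [|h /andP[h0 ht]]; first by rewrite subr_gt0.
  by rewrite !edge_pt_tgt//; lra.
Unshelve. all: by end_near. Qed.

Lemma gpl_out f : (forall x d, outgoing x d -> exists m, dgerm f x d m) -> gpl f.
Proof.
move=> H e t b; have [[xd E]|st] := edge_pt_dir e t b.
  by have [m] := H _ _ xd; rewrite /dgerm /= E; exists m.
by exists 0; apply: filterS st => h /= ->; rewrite mul0r addr0.
Qed.

Lemma edge_pt_continuous e : continuous (@edge_pt R G e).
Proof. by apply/continuousP => U; exact. Qed.

Lemma rational_gpl f : rational_function f -> gpl f.
Proof.
move=> [_ H]; apply: gpl_out => x d xd.
have [s ps As] := H d.1.
have [g1 g2 _] := germ_affine_pieces ps As.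
have := edge_coord_room xd; have := edge_coord_itv xd.
rewrite /dgerm; case: (d.2) => /andP[c0 cl] /andP[r0 rl].
  by apply: g1; rewrite c0 -subr_gt0.
by apply: g2; rewrite r0.
Qed.

Lemma gpl_rational f : gpl f -> rational_function f.
Proof.
move=> F; split=> [|e]; last exact: pl_affine_pieces (F e) (mg_len_gt0 e).
apply/continuousP => U oU.
have : graph_open (f @^-1` U); last exact.
by move=> e; have /continuousP C := pl_continuous (F e); exact: C.
Qed.

Lemma ord_gplD f g x : gpl f -> gpl g -> ord (fun y => f y + g y) x = ord f x + ord g x.
Proof.
move=> F H; rewrite /ord -big_split/=; apply: eq_bigr => d xd.
have [m gm ->] := gpl_slope F xd; have [p gp ->] := gpl_slope H xd.
by rewrite -intrD; apply: slope_dgerm => //; exact: (germD gm gp).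
Qed.

Lemma ord_gplN f x : gpl f -> ord (fun y => - f y) x = - ord f x.
Proof.
move=> F; rewrite /ord -sumrN; apply: eq_bigr => d xd.
have [m gm ->] := gpl_slope F xd.
by rewrite -mulrNz; apply: slope_dgerm => //; exact: (germN gm).
Qed.

Lemma ord_cst (c : R) x : ord (fun=> c) x = 0.
Proof.
rewrite /ord big1// => d xd; rewrite -[RHS](mulr0z 1); apply: slope_dgerm => //.
exact: germ_cst.
Qed.

Lemma ord_int f x : gpl f -> exists n : int, ord f x = n%:~R.
Proof.
move=> F; apply: (big_ind (fun r => exists n : int, r = n%:~R)).
- by exists 0.
- by move=> _ _ [m ->] [n ->]; exists (m + n); rewrite intrD.
- by move=> d xd; have [m _ ->] := gpl_slope F xd; exists m.
Qed.

Lemma ord_interior f e t : 0 < t < mg_len e ->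
  ord f (edge_pt e t) =
    slope f (edge_pt e t) (e, true) + slope f (edge_pt e t) (e, false).
Proof.
move=> /edge_ptE[y -> Ey].
have P d : outgoing (inr y) d = (d \in [:: (e, true); (e, false)]).
  by case: d => e' b; rewrite !inE /= Ey /= !xpair_eqE eq_sym -andb_orr; case: b; rewrite andbT.
rewrite /ord (eq_bigl _ _ P) -big_uniq; last by rewrite /= inE xpair_eqE eqxx.
by rewrite big_cons big_seq1.
Qed.

Lemma shift_itv_lt (b : bool) (c L h : R) : 0 <= c <= L -> 0 < h < (if b then L - c else c) ->
  0 < c + (if b then h else - h) < L.
Proof. by case: b => /andP[? ?] /andP[? ?]; apply/andP; split; lra. Qed.

Lemma shift_itv_le (b : bool) (c L h : R) : 0 <= c <= L -> 0 <= h <= (if b then L - c else c) ->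
  0 <= c + (if b then h else - h) <= L.
Proof. by case: b => /andP[? ?] /andP[? ?]; apply/andP; split; lra. Qed.

(** [l] is the least positive signed distance along [d] to a chip, or to the end of the edge. Chips
    behind [x] have distance [<= 0] and are ignored by [exists_min_pos]; a chip at the far vertex is
    covered by [L]. *)
Lemma next_node D x d : outgoing x d -> exists2 l, 0 < l &
  [/\ forall h, 0 < h < l -> coeff (ray x d h) D = 0 /\
        0 < edge_coord x d + (if d.2 then h else - h) < mg_len d.1,
      0 <= edge_coord x d + (if d.2 then l else - l) <= mg_len d.1 &
      (exists v, ray x d l = inl v) \/ ray x d l \in dom D].
Proof.
move=> xd; set c := edge_coord x d.
pose L := if d.2 then mg_len d.1 - c else c.
have := edge_coord_room xd; rewrite -/c -/L => /andP[L0 Ll].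
pose pos y := edge_coord y d - c.
have [l /andP[l0 lL] [ls lmin]] := exists_min_pos
  [seq (if d.2 then pos y else - pos y) | y <- dom D & outgoing y d] L0.
have c_itv := edge_coord_itv xd; rewrite -/c in c_itv.
exists l => //; split.
- move=> h /andP[h0 hl].
  have H : 0 < c + (if d.2 then h else - h) < mg_len d.1.
    by apply: shift_itv_lt => //; rewrite h0 (lt_le_trans hl).
  split=> //; apply: coeff_outdom; apply/negP => yD.
  have Hb : if d.2 then 0 <= c + (if d.2 then h else - h) < mg_len d.1
      else 0 < c + (if d.2 then h else - h) <= mg_len d.1.
    by case/andP : H; case: (d.2) => H1 H2; rewrite ?H1 ?H2 ?ltW.
  have [ox E] := edge_pt_out Hb; move: ox E; rewrite -surjective_pairing => ox E.
  have := lmin h; rewrite leNgt hl h0 => H2.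
  suff /H2 : h \in [seq (if d.2 then pos y else - pos y) | y <- dom D & outgoing y d]
    by move/(_ isT).
  apply/mapP; exists (ray x d h); first by rewrite mem_filter ox.
  by rewrite /pos E; case: (d.2); rewrite addrC addKr ?opprK.
- by apply: shift_itv_le => //; rewrite (ltW l0).
- case: ls => [->|/mapP[y]].
    left; rewrite /ray -/c /L; case: (d.2).
      by exists (mg_tgt d.1); rewrite addrC subrK edge_pt_tgt.
    by exists (mg_src d.1); rewrite subrr edge_pt_src.
  rewrite mem_filter => /andP[yd yD] lE; right.
  rewrite (_ : ray x d l = y)//.
  rewrite -(edge_pt_coord yd) /ray -/c lE /pos; congr edge_pt.
  by case: (d.2); rewrite ?opprK addrC subrK.
Qed.

End EdgeGerms.

(** * Convexity along a segment *)

Section Rays.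
Context {R : realType}.
Implicit Types (phi : R -> R) (a b c t h : R) (m p q : int).

Lemma germ_shift phi c (b d : bool) t m :
  germ (fun h => phi (c + (if b then h else - h))) t d m <->
  germ phi (c + (if b then t else - t)) (if b then d else ~~ d) m.
Proof.
rewrite /germ; split; apply: filterS => h; rewrite -addrA => <-; congr (phi (c + _));
  by case: b; case: d => //=; rewrite opprD ?opprK.
Qed.

Lemma pl_shift phi c (b : bool) : pl phi -> pl (fun h => phi (c + (if b then h else - h))).
Proof.
move=> P t d.
by have [m gm] := P (c + (if b then t else - t)) (if b then d else ~~ d); exists m;
  apply/germ_shift.
Qed.

(** A descent is an ascent seen from a nearby point, so upper bounds on slopes yield lower
    bounds. *)
Lemma germ_flip phi t m : germ phi t true m ->
  \forall h \near 0^'+, germ phi (t + h) false (- m).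
Proof.
move=> /near0P[e e0 H]; near=> h.
have /andP[h0 he] : 0 < h < e by near: h; exact: near0_lt.
apply/near0P; exists h => // k /andP[k0 kh].
have Hh : phi (t + h) = phi t + m%:~R * h by apply: H; rewrite h0 ltW.
rewrite /= Hh mulrNz; move: kh; rewrite le_eqVlt => /predU1P[->|kh].
  by rewrite addrK mulNr addrK.
rewrite -addrA H; first by ring.
by apply/andP; split; lra.
Unshelve. all: by end_near. Qed.

(** What [D + (f) >= 0] says inside a stretch of edge without chips of [D]. The ends are left out
    because a vertex or a chip may sit there. *)
Definition convex_germs phi a b := forall t p q, a < t < b ->
  germ phi t true p -> germ phi t false q -> 0 <= p + q.

(** The reflection [t -> - t] swaps the two directions and reduces this to [convex_germ_le]. *)
Lemma convex_germ_ge phi a b q : pl phi -> convex_germs phi a b ->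
  germ phi b false q -> forall t, a <= t <= b -> phi b + q%:~R * (b - t) <= phi t.
Proof.
move=> P cvx gq t /andP[at_ tb].
have gq' : germ (phi \o -%R) (- b) true q by exact: (germ_opp gq).
have := @convex_germ_le R (phi \o -%R) (- b) (- a) q (pl_opp P) _ gq' (- t).
rewrite /= !opprK [- t + b]addrC; apply; last by rewrite !lerN2 at_ tb.
move=> s p r /andP[bs sa] gp gr.
have := cvx (- s) r p; rewrite addrC; apply.
- by apply/andP; split; lra.
- by have := germ_opp gr; congr germ; apply/funext => x /=; rewrite opprK.
- by have := germ_opp gp; congr germ; apply/funext => x /=; rewrite opprK.
Qed.

(** To the right of [t] this is [convex_germ_le]. To the left, [convex_germ_ge] gives a line with
    the left slope [q], and [q >= - p] keeps the line of slope [p] below it. *)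
Lemma convex_support phi a b t p : pl phi -> convex_germs phi a b -> a <= t < b ->
  germ phi t true p -> forall s, a <= s <= b -> phi t + p%:~R * (s - t) <= phi s.
Proof.
move=> P cvx /andP[at_ tb] gp s /andP[as_ sb].
have [ts|st] := leP t s.
  apply: (@convex_germ_le R phi t b) => //; last by rewrite ts.
  by move=> u p' q' /andP[tu ub]; apply: cvx; rewrite ub (le_lt_trans at_).
have [q gq] := P t false.
have alt : a < t by exact: le_lt_trans st.
have := cvx t p q; rewrite alt tb => /(_ isT gp gq); rewrite -(ler_int R) intrD => pq.
have := @convex_germ_ge phi a t q P _ gq s; rewrite as_ (ltW st) => H.
apply: le_trans (H _ isT); last first.
  by move=> u p' q' /andP[au ut]; apply: cvx; rewrite au (lt_trans ut).
rewrite lerD2l; nra.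
Qed.

End Rays.

(** * Divisors of functions and linear systems *)

Section Divisors.
Context {R : realType} {G : metric_graph R}.
Implicit Types (e : mg_edge G) (t h : R) (x y : mg_point G) (D E : {freeg (mg_point G)}).
Implicit Types (f g : mg_point G -> R) (d : mg_edge G * bool) (m p q : int).

(** Vertices and subdivision points are the only candidates for the support; [undup] counts each
    once. The floor only turns an integral real into an [int]. *)
Lemma gpl_is_div f : gpl f -> exists E, is_div f E.
Proof.
move=> F.
have S e : {s : seq R | itv_partition 0 (mg_len e) s /\ affine_pieces (f \o edge_pt e) 0 s}.
  by apply: cid; have [s] := pl_affine_pieces (F e) (mg_len_gt0 e); exists s.
pose N := undup ([seq inl v | v <- enum (mg_vertex G)] ++
  flatten [seq [seq edge_pt e t | t <- sval (S e)] | e <- enum (mg_edge G)]).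
pose n x := Num.floor (ord f x).
have nE x : (n x)%:~R = ord f x by rewrite /n; have [k ->] := ord_int x F; rewrite intrKfloor.
exists (\sum_(x <- N) << n x *g x >>) => x.
rewrite raddf_sum /=; under eq_bigr do rewrite coeffU.
have [xN|xN] := boolP (x \in N).
  rewrite (bigD1_seq x) ?undup_uniq//= eqxx mulr1 big1 ?addr0// => y yx.
  by rewrite (negbTE yx) mulr0.
rewrite big_seq big1; last first.
  by move=> y yN; case: eqP => [yx|]; [rewrite -yx yN in xN | rewrite mulr0].
move: xN; rewrite mem_undup mem_cat negb_or => /andP[].
case: x => [v|y] xN; first by rewrite map_f ?mem_enum in xN.
case: y xN => -[e t] /= te _ xN.
have ts : t \notin sval (S e).
  apply: contra xN => ts; apply/flatten_mapP; exists e; first by rewrite mem_enum.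
  by apply/mapP; exists t => //; rewrite edge_pt_inr.
have [ps As] := svalP (S e); have [_ _ /(_ t te ts)[m gm gm']] := germ_affine_pieces ps As.
rewrite -edge_pt_inr ord_interior//.
have /andP[t0 tl] := te.
have [out1 c1] := @edge_pt_out R G e t true ltac:(by rewrite tl ltW).
have [out2 c2] := @edge_pt_out R G e t false ltac:(by rewrite t0 ltW).
rewrite (@slope_dgerm _ _ _ _ (e, true) m)// ?(@slope_dgerm _ _ _ _ (e, false) (- m))//.
- by rewrite mulrNz subrr mulr0z.
- by rewrite /dgerm c2.
- by rewrite /dgerm c1.
Qed.

Lemma lin_equiv_refl D : lin_equiv D D.
Proof.
exists (fun=> 0); first exact/gpl_rational/gpl_cst.
by move=> x; rewrite subrr coeff0 ord_cst.
Qed.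

Lemma lin_equiv_sym D E : lin_equiv D E -> lin_equiv E D.
Proof.
move=> [f /rational_gpl F H]; exists (fun x => - f x); first exact/gpl_rational/gplN.
by move=> x; rewrite ord_gplN// -H -mulrNz -coeffN opprB.
Qed.

Lemma lin_equiv_trans D D' E : lin_equiv D D' -> lin_equiv D' E -> lin_equiv D E.
Proof.
move=> [f /rational_gpl F H] [g /rational_gpl F' H'].
exists (fun x => f x + g x); first exact/gpl_rational/gplD.
by move=> x; rewrite ord_gplD// -H -H' -intrD -coeffD addrA subrK.
Qed.

Lemma linear_system_equiv D D' : lin_equiv D D' -> linear_system D = linear_system D'.
Proof.
move=> DD'; apply/seteqP; split=> E [eE ED]; split=> //; apply: lin_equiv_trans ED _ => //.
exact: lin_equiv_sym.
Qed.

(* The functions f with D + (f) >= 0, i.e. the paper's R(D). *)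
Definition sections D : set (mg_point G -> R) :=
  [set f | gpl f /\ forall x, 0 <= (coeff x D)%:~R + ord f x].

Lemma sections_div D f : sections D f -> exists2 E, linear_system D E &
  forall x, (coeff x E)%:~R = (coeff x D)%:~R + ord f x.
Proof.
move=> [F H]; have [E HE] := gpl_is_div F; exists (D + E).
  split=> [x|]; first by rewrite -(ler_int R) coeffD intrD HE H.
  exists f; first exact: gpl_rational.
  by move=> x; rewrite addrC addKr HE.
by move=> x; rewrite coeffD intrD HE.
Qed.

Lemma linear_system_sections D E : linear_system D E -> exists2 f, sections D f &
  forall x, (coeff x E)%:~R = (coeff x D)%:~R + ord f x.
Proof.
move=> [eE [f F H]].
have H' x : (coeff x E)%:~R = (coeff x D)%:~R + ord f x :> R.
  by rewrite -H coeffB intrB addrC subrK.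
exists f => //; split; first exact: rational_gpl.
by move=> x; rewrite -H' ler0z.
Qed.

Lemma gpl_ray f x d : gpl f -> pl (fun h => f (ray x d h)).
Proof. by move=> F; exact: (pl_shift (edge_coord x d) d.2 (F d.1)). Qed.

Lemma germ_ray f x d h (b : bool) m :
  germ (fun h => f (ray x d h)) h b m <->
  germ (f \o edge_pt d.1) (edge_coord x d + (if d.2 then h else - h)) (if d.2 then b else ~~ b) m.
Proof. exact: (germ_shift (f \o edge_pt d.1)). Qed.

Lemma germ_ray0 f x d m : germ (fun h => f (ray x d h)) 0 true m <-> dgerm f x d m.
Proof.
rewrite germ_ray /dgerm oppr0 if_same addr0.
by rewrite (_ : (if d.2 then true else ~~ true) = d.2)//; case: (d.2).
Qed.

Lemma ray_out x d h (b : bool) : outgoing x d ->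
  (if b then 0 <= h < (if d.2 then mg_len d.1 - edge_coord x d else edge_coord x d)
   else 0 < h <= (if d.2 then mg_len d.1 - edge_coord x d else edge_coord x d)) ->
  outgoing (ray x d h) (d.1, if d.2 then b else ~~ b) /\
  edge_coord (ray x d h) (d.1, if d.2 then b else ~~ b) = edge_coord x d + (if d.2 then h else -
    h).
Proof.
move=> xd H; apply: edge_pt_out.
have := edge_coord_itv xd; case: (d.2) H; case: b => /andP[H1 H2] /andP[H3 H4]; apply/andP;
  split; lra.
Qed.

Lemma dgerm_ray f x d h (b : bool) m : outgoing x d ->
  (if b then 0 <= h < (if d.2 then mg_len d.1 - edge_coord x d else edge_coord x d)
   else 0 < h <= (if d.2 then mg_len d.1 - edge_coord x d else edge_coord x d)) ->
  germ (fun h => f (ray x d h)) h b m <->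
  dgerm f (ray x d h) (d.1, if d.2 then b else ~~ b) m.
Proof.
move=> xd H; have [_ E] := ray_out xd H.
by rewrite germ_ray /dgerm E.
Qed.

Lemma ord_ray f x d h p q : outgoing x d ->
  0 < h < (if d.2 then mg_len d.1 - edge_coord x d else edge_coord x d) ->
  germ (fun h => f (ray x d h)) h true p -> germ (fun h => f (ray x d h)) h false q ->
  ord f (ray x d h) = (p + q)%:~R.
Proof.
move=> xd /andP[h0 hl].
have H1 : 0 <= h < (if d.2 then mg_len d.1 - edge_coord x d else edge_coord x d) by rewrite hl ltW.
have H2 : 0 < h <= (if d.2 then mg_len d.1 - edge_coord x d else edge_coord x d) by rewrite h0 ltW.
have [out1 _] := ray_out (b := true) xd H1; have [out2 _] := ray_out (b := false) xd H2.
move=> /(dgerm_ray f (b := true) _ xd H1) /(slope_dgerm out1) s1.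
move=> /(dgerm_ray f (b := false) _ xd H2) /(slope_dgerm out2) s2.
rewrite /ray ord_interior; last by apply: shift_itv_lt; [exact: edge_coord_itv | rewrite h0].
rewrite -/(ray x d h) intrD -s1 -s2.
by case: (d.2) => //=; rewrite addrC.
Qed.

End Divisors.

(** * Slope bounds and reduced divisors *)

Section Sections.
Context {R : realType} {G : metric_graph R}.
Implicit Types (e : mg_edge G) (t h l : R) (x y : mg_point G) (D E : {freeg (mg_point G)}).
Implicit Types (f g : mg_point G -> R) (d : mg_edge G * bool) (m p q : int).

Definition room x d : R := if d.2 then mg_len d.1 - edge_coord x d else edge_coord x d.

Definition free_ray D x d l := 0 < l <= room x d /\
  forall h, 0 < h < l -> coeff (ray x d h) D = 0.

Lemma exists_free_ray D x d : outgoing x d -> exists2 l, free_ray D x d l &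
  (exists v, ray x d l = inl v) \/ ray x d l \in dom D.
Proof.
move=> xd; have [l l0 [H1 H2 H3]] := next_node D xd; exists l => //; split.
  by rewrite l0 /=; move: H2; rewrite /room; case: (d.2) => /andP[? ?]; lra.
by move=> h /H1[].
Qed.

Lemma sections_convex_ray D f x d l : sections D f -> outgoing x d -> free_ray D x d l ->
  convex_germs (fun h => f (ray x d h)) 0 l.
Proof.
move=> [F H] xd [/andP[l0 lr] free] h p q /andP[h0 hl] gp gq.
have := H (ray x d h); rewrite free ?h0// mulr0z add0r (ord_ray xd _ gp gq) ?ler0z//.
by rewrite h0 (lt_le_trans hl).
Qed.

Lemma sections_ray_le D f x d l m : sections D f -> outgoing x d -> free_ray D x d l ->
  dgerm f x d m -> forall h, 0 <= h <= l -> f x + m%:~R * h <= f (ray x d h).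
Proof.
move=> Df xd fr gm' h hl; have gm := (germ_ray0 f x d m).2 gm'.
have := convex_germ_le (gpl_ray x d Df.1) (sections_convex_ray Df xd fr) gm hl.
by rewrite (ray0 xd) subr0.
Qed.

(** The points at which a section may fail to be convex. A chip at a vertex is listed twice, which
    does not disturb the counting below. *)
Definition node_seq D : seq (mg_point G) := [seq inl v | v <- enum (mg_vertex G)] ++ dom D.

Definition chip_bound D : int := \sum_(z <- dom D) `|coeff z D|.

Lemma coeff_chip_bound D x : coeff x D <= chip_bound D.
Proof.
have [xD|xD] := boolP (x \in dom D); last by rewrite (coeff_outdom xD) sumr_ge0.
rewrite /chip_bound (bigD1_seq x) ?uniq_dom//= (le_trans (ler_norm _))// lerDl.
exact: sumr_ge0.
Qed.

Lemma chip_bound_ge0 D : 0 <= chip_bound D.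
Proof. exact: sumr_ge0. Qed.

(** A bound for a slope [m] at a point with at most [k] higher nodes. At the next node the slope
    back is at most [- m], the other slopes obey the bound for [k'], and all of them add up to at
    least minus the chips there. Solving for [m] gives the recursion, with all pairs of an edge and
    a sign as a crude count of directions. *)
Fixpoint slope_bound D (k : nat) : int :=
  if k is k'.+1 then chip_bound D + slope_bound D k' *+ #|{: mg_edge G * bool}| else 0.

Lemma slope_bound_ge0 D k : 0 <= slope_bound D k.
Proof.
by elim: k => //= k IH; rewrite addr_ge0 ?chip_bound_ge0// mulrn_wge0.
Qed.

(* A section climbing along d from x is convex up to the next node, which it
   reaches from below with at least the same slope; there it has to climb further,
   and the number of nodes above has decreased. *)
Lemma sections_slope_le D f : sections D f -> forall k x d m,
  (count (fun y => (f x < f y)%R) (node_seq D) <= k)%N ->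
  outgoing x d -> dgerm f x d m -> m <= slope_bound D k.
Proof.
move=> Df; elim=> [|k IH] x d m cnt xd gm.
all: have [m0|m0] : m <= 0 \/ 0 < m by case: (leP m 0); [left | right].
1,3: exact: le_trans m0 (slope_bound_ge0 _ _).
all: have [l fr yN] := exists_free_ray D xd.
all: have {yN}yN : ray x d l \in node_seq D by
  case: yN => [[v ->]|yD]; rewrite mem_cat ?yD ?orbT// map_f ?mem_enum.
all: have [/andP[l0 lr] _] := fr.
all: have ll : 0 <= l <= l by rewrite lexx ltW.
all: have fy := sections_ray_le Df xd fr gm ll.
all: have xy : f x < f (ray x d l) by rewrite (lt_le_trans _ fy)// ltrDl mulr_gt0// ltr0z.
  suff : (0 < count (fun y => (f x < f y)%R) (node_seq D))%N by rewrite lt0n -leqn0 cnt.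
  by rewrite -has_count; apply/hasP; exists (ray x d l).
have {}IH d' m' : outgoing (ray x d l) d' -> dgerm f (ray x d l) d' m' -> m' <= slope_bound D k.
  apply: IH; rewrite -ltnS; apply: leq_trans cnt.
  have [s1 [s2 ->]] : exists s1 s2, node_seq D = s1 ++ ray x d l :: s2.
    by case/splitPr: yN => s1 s2; exists s1, s2.
  rewrite !count_cat /= ltxx xy add0n add1n addnS ltnS.
  by apply: leq_add; apply: sub_count => z /= /(lt_trans xy).
have rl : 0 < l <= (if d.2 then mg_len d.1 - edge_coord x d else edge_coord x d) by rewrite l0.
have [out _] := ray_out (b := false) xd rl.
have [q gq] := gpl_dgerm (ray x d l) (d.1, if d.2 then false else ~~ false) Df.1.
have := gq; rewrite -(dgerm_ray f (b := false) q xd rl) => gq'.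
have qm : q <= - m.
  have := convex_germ_ge (gpl_ray x d Df.1) (sections_convex_ray Df xd fr) gq' (t := 0).
  rewrite lexx ltW// => /(_ isT); rewrite (ray0 xd) subr0 => H.
  by rewrite -(ler_int R) mulrNz -(ler_pM2r l0); lra.
have := Df.2 (ray x d l).
rewrite /ord (bigD1 _ out) /= (slope_dgerm out gq).
set S := \sum_(_ | _) _ => H.
have SB : S <= (slope_bound D k *+ #|{: mg_edge G * bool}|)%:~R.
  apply: (@le_trans _ _ (\sum_(d' : mg_edge G * bool) (slope_bound D k)%:~R)); last first.
    by rewrite sumr_const rmorphMn.
  rewrite [leRHS](bigID (fun d' => outgoing (ray x d l) d' && (d' != (d.1, if d.2 then false
    else ~~ false))))/=.
  rewrite -[leLHS]addr0; apply: lerD; last by apply: sumr_ge0 => d' _;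
    rewrite ler0z slope_bound_ge0.
  apply: ler_sum => d' /andP[od' _]; have [m' gm' ->] := gpl_slope Df.1 od'.
  by rewrite ler_int (IH d').
have cb := coeff_chip_bound D (ray x d l); rewrite -(ler_int R) in cb.
rewrite -(ler_int R) in qm; rewrite mulrNz in qm.
by rewrite /= -(ler_int R) intrD; lra.
Qed.

(** There are never more higher nodes than nodes, which makes the bound uniform in [f] and [x]. The
    lower bound is the upper one for the direction looking back from a nearby point. *)
Lemma sections_slope_bounded D : exists2 M : int, 0 <= M & forall f x d m, sections D f ->
  outgoing x d -> dgerm f x d m -> - M <= m <= M.
Proof.
exists (slope_bound D (size (node_seq D))) => [|f x d m Df xd gm]; first exact: slope_bound_ge0.
have up y d' p : outgoing y d' -> dgerm f y d' p -> p <= slope_bound D (size (node_seq D)).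
  by apply: (sections_slope_le Df); exact: count_size.
rewrite (up _ _ _ xd gm) andbT lerNl.
have /germ_flip fl := (germ_ray0 f x d m).2 gm.
have [/andP[r0 _]] := edge_coord_room xd.
near (0 : R)^'+ => h.
have /andP[h0 hr] : 0 < h < room x d by near: h; apply: near0_lt; case/andP: (edge_coord_room xd).
have rh : 0 < h <= (if d.2 then mg_len d.1 - edge_coord x d else edge_coord x d) by rewrite h0 ltW.
have [out _] := ray_out (b := false) xd rh.
apply: (up _ _ _ out).
apply: (dgerm_ray f (b := false) (- m) xd rh).1.
by rewrite -[h]add0r; near: h.
Unshelve. all: by end_near. Qed.

(** Uniformly bounded slopes spread a bound along each edge, and connectedness spreads it over the
    graph, starting from [v], where all these functions vanish. *)
Lemma sections_bounded D v x : exists C, forall f, sections D f -> f v = 0 -> f x <= C.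
Proof.
have [M _ HM] := sections_slope_bounded D.
pose Bd y := exists C, forall f, sections D f -> f v = 0 -> f y <= C.
have step y d h : outgoing y d -> 0 <= h <= room y d -> Bd y -> Bd (ray y d h).
  move=> yd /andP[h0 hr] [C HC]; exists (C + (M%:~R + 1) * h) => f Df fv.
  have := @pl_le_slope R (fun h => f (ray y d h)) M%:~R 0 h (gpl_ray y d Df.1) h0.
  rewrite (ray0 yd) subr0 => H; apply: le_trans (H _) _; last by rewrite lerD2r HC.
  move=> t q /andP[t0 th].
  have rt : 0 < t <= (if d.2 then mg_len d.1 - edge_coord y d else edge_coord y d).
    by rewrite t0 (le_trans th).
  have [out _] := ray_out (b := false) yd rt.
  move=> /((dgerm_ray f (b := false) q yd rt).1) /(HM _ _ _ _ Df out) /andP[+ _].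
  by rewrite -(ler_int R) mulrNz.
have st y e t b : outgoing y (e, b) -> 0 <= t <= mg_len e ->
    (if b then edge_coord y (e, b) <= t else t <= edge_coord y (e, b)) -> Bd y -> Bd (edge_pt e t).
  move=> yd /andP[t0 tl] le By.
  have := step y (e, b) (if b then t - edge_coord y (e, b) else edge_coord y (e, b) - t) yd.
  rewrite /ray /room /=; case: b yd le => yd le.
    by rewrite [_ + (t - _)]addrC subrK; apply=> //; rewrite subr_ge0 le lerB.
  by rewrite subKr; apply=> //; rewrite subr_ge0 le gerBl.
have Bv : Bd v by exists 0 => f _ ->.
have E e y : (y = inl (mg_src e) \/ y = inl (mg_tgt e)) -> Bd y ->
  forall t, 0 <= t <= mg_len e -> Bd (edge_pt e t).
  move=> yE By t /andP[t0 tl]; case: yE By => -> By.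
    by apply: (st _ e t true _ _ _ By) => //=; rewrite ?eqxx// t0.
  by apply: (st _ e t false _ _ _ By) => //=; rewrite ?eqxx// t0.
have E1 e : Bd (inl (mg_src e)) -> Bd (inl (mg_tgt e)).
  move=> By; rewrite -(@edge_pt_tgt R G e (mg_len e))//.
  by apply: (E e _ (or_introl erefl) By); rewrite lexx ltW// mg_len_gt0.
have E2 e : Bd (inl (mg_tgt e)) -> Bd (inl (mg_src e)).
  move=> By; rewrite -(@edge_pt_src R G e 0)//.
  by apply: (E e _ (or_intror erefl) By); rewrite lexx ltW// mg_len_gt0.
have [w Bw] : exists w, Bd (inl w).
  case v_eq : v => [w|[[e t] te]]; first by exists w; rewrite -v_eq.
  exists (mg_src e); rewrite -(@edge_pt_src R G e 0)//.
  apply: (st v e 0 false) => //; first by rewrite v_eq /=.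
    by rewrite lexx ltW ?mg_len_gt0.
  by rewrite v_eq /=; have /andP[/ltW] := te.
have Ball u : Bd (inl u).
  have /connectP[p] := mg_connected w u.
  elim: p w Bw => [|z p IH] w Bw /=; first by move=> _ ->.
  move=> /andP[/existsP[e He] pz] uE; apply: (IH z) => //.
  move: Bw; case/orP: He => /andP[/eqP <- /eqP <-]; [exact: E1 | exact: E2].
case: x => [u|[[e t] te]]; first exact: Ball.
rewrite -edge_pt_inr; apply: (E e (inl (mg_src e))); [by left | exact: Ball |].
by case/andP: te => /= t0 tl; rewrite !ltW.
Qed.

End Sections.

Section MaximalSection.
Context {R : realType} {G : metric_graph R}.
Implicit Types (e : mg_edge G) (t h l : R) (x y : mg_point G) (D E : {freeg (mg_point G)}).
Implicit Types (f g : mg_point G -> R) (d : mg_edge G * bool) (m p q : int).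

Lemma sections0 D : effective D -> sections D (fun=> 0).
Proof. by move=> eD; split=> [|x]; [exact: gpl_cst | rewrite ord_cst addr0 ler0z]. Qed.

Section Sup.
Variables (D : {freeg (mg_point G)}) (v : mg_point G).
Hypothesis eD : effective D.

Let A : set (mg_point G -> R) := [set f | sections D f /\ f v = 0].
Let F x := sup [set f x | f in A].

Let A0 : A (fun=> 0).
Proof. by split=> //; exact: sections0. Qed.

Let F_sup x : has_sup [set f x | f in A].
Proof.
split; first by exists 0, (fun=> 0).
by have [C HC] := sections_bounded D v x; exists C => _ [f [Df fv] <-]; exact: HC.
Qed.

Let F_ge f x : A f -> f x <= F x.
Proof. by move=> Af; apply: ub_le_sup; [exact: (F_sup x).2 | exists f]. Qed.

(* On a free ray every section is the maximum of its support lines, of which only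
   boundedly many slopes occur; hence so is F. *)
Let F_gpl : gpl F.
Proof.
have [M M0 HM] := sections_slope_bounded D.
apply: gpl_out => x d xd; have [l fr _] := exists_free_ray D xd.
have [/andP[l0 lr] _] := fr.
(* Through [j] these indices enumerate the integers from [- M] to [M], which include all slopes of
   sections. *)
pose I := 'I_(absz M + absz M).+1.
pose j (i : I) : int := (i : nat)%:Z - M.
(* Intercepts of the lines of slope [j i] below some section along the ray; their supremum gives one
   line of the finite maximum. *)
pose S i := [set a | exists2 f, A f & forall h, 0 <= h <= l -> a + (j i)%:~R * h <= f (ray x d h)].
have S0 i : S i !=set0.
  (* Above a low enough line of any slope lies the zero section. An empty [S i] would have supremum
     0 by convention and spoil the lower bound. *)
  exists (- (`|j i|%:~R * l)), (fun=> 0) => // h /andP[h0 hl].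
  have n0 : (0 : R) <= `|j i|%:~R by rewrite ler0z.
  have H1 : (j i)%:~R <= `|j i|%:~R :> R by rewrite ler_int ler_norm.
  nra.
have S_le i a h : S i a -> 0 <= h <= l -> a + (j i)%:~R * h <= F (ray x d h).
  by move=> [f Af H] hl; apply: le_trans (H h hl) _; exact: F_ge.
have S_sup i : has_ubound (S i).
  exists (F (ray x d 0)) => a Sa; have := S_le i a 0 Sa.
  by rewrite lexx ltW// mulr0 addr0; exact.
(* Half of the ray, because a support line at [h] requires [h < l]. *)
have l20 : 0 < l / 2 by rewrite divr_gt0.
apply: (@germ_max_lines R I _ _ _ (fun i => sup (S i)) j (l / 2) l20) =>
  [i h /andP[h0 hl]|h /andP[h0 hl]].
  rewrite -lerBrDr; apply: ge_sup => // a Sa; rewrite lerBrDr; apply: S_le => //.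
  by apply/andP; split; lra.
have hlt : h < l by lra.
have [k _ kmax] := @Order.TotalTheory.arg_maxP _ _ _ (ord0 : I) xpredT
  (fun i => sup (S i) + (j i)%:~R * h) isT.
exists k; apply: ge_sup => [|_ [f Af <-]]; first by exists 0, (fun=> 0).
have hr : 0 <= h < (if d.2 then mg_len d.1 - edge_coord x d else edge_coord x d).
  by rewrite h0 (lt_le_trans hlt).
have [p gp] := gpl_ray x d Af.1.1 h true.
have [out _] := ray_out (b := true) xd hr.
have /andP[pM Mp] := HM _ _ _ _ Af.1 out ((dgerm_ray f (b := true) p xd hr).1 gp).
have [i ip] : exists i : I, j i = p.
  have H : (absz (p + M)%R < (absz M + absz M).+1)%N.
    have pM0 : 0 <= p + M by rewrite -lerBlDr sub0r.
    rewrite ltnS -lez_nat PoszD !gez0_abs//; exact: lerD.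
  exists (Ordinal H); rewrite /j /= gez0_abs ?addrK//.
  by rewrite -lerBlDr sub0r.
apply: le_trans (kmax i isT).
rewrite -lerBlDr; apply: ub_le_sup => //; exists f => // s sl.
have H := convex_support (gpl_ray x d Af.1.1) (sections_convex_ray Af.1 xd fr) _ gp sl.
have {H}H : f (ray x d h) + p%:~R * (s - h) <= f (ray x d s) by apply: H; rewrite h0.
by rewrite ip; apply: le_trans H; rewrite le_eqVlt; apply/orP; left; apply/eqP; rewrite /ray; ring.
Qed.

(* A section close to F at x has slopes at most those of F there, because slopes
   are integers. *)
Let F_sections : sections D F.
Proof.
split=> // x.
have [l Hl] : {l : mg_edge G * bool -> R & forall d, outgoing x d -> free_ray D x d (l d)}.
  apply: (@choice _ _ (fun d l => outgoing x d -> free_ray D x d l)) => d.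
  have [xd|xd] := boolP (outgoing x d); last by exists 0 => /negP.
  by have [l fr _] := exists_free_ray D xd; exists l.
have [p Hp] : {p : mg_edge G * bool -> int & forall d, dgerm F x d (p d)}.
  by apply: choice => d; exact: gpl_dgerm.
have H : \forall h \near (0 : R)^'+, forall d, outgoing x d ->
    h <= l d /\ F (ray x d h) = F x + (p d)%:~R * h.
  apply: filter_forall => d.
  have [xd|xd] := boolP (outgoing x d); last by near=> h.
  have ld : 0 < l d by have [/andP[]] := Hl d xd.
  have := (dgermP F (p d) xd).1 (Hp d) => gF.
  near=> h => _; split; last by near: h.
  by have /andP[_ /ltW] : 0 < h < l d by near: h; exact: near0_lt.
near (0 : R)^'+ => h.
have h0 : 0 < h by [].
have Hh : forall d, outgoing x d -> h <= l d /\ F (ray x d h) = F x + (p d)%:~R * h by near: h.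
(* A defect at [x] below [h / 2] gives [m * h < p d * h + h], hence [m <= p d] for integers. *)
have h20 : 0 < h / 2 by rewrite divr_gt0.
have [_ [f Af <-] fx] := sup_adherent h20 (F_sup x); rewrite -/(F x) in fx.
apply: le_trans (Af.1.2 x) _; rewrite lerD2l; apply: ler_sum => d xd.
have [m gm ->] := gpl_slope Af.1.1 xd; rewrite (slope_dgerm xd (Hp d)) ler_int.
have [hl Fr] := Hh d xd.
have := sections_ray_le Af.1 xd (Hl d xd) gm (h := h); rewrite (ltW h0) hl => /(_ isT) H1.
have H2 := F_ge (ray x d h) Af; rewrite Fr in H2.
have : m%:~R * h < (p d + 1)%:~R * h :> R by rewrite intrD; lra.
by rewrite ltr_pM2r// ltr_int ltzD1.
Unshelve. all: by end_near. Qed.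

Lemma exists_max_section : exists F, [/\ sections D F, F v = 0 &
  forall f, sections D f -> f v = 0 -> forall x, f x <= F x].
Proof.
exists F; split=> //; last by move=> f Df fv x; exact: F_ge.
rewrite /F (_ : [set _ | _ in _] = [set 0]) ?sup1//.
apply/seteqP; split=> [_ [f [_ fv] <-]//|_ ->]; by exists (fun=> 0).
Qed.

End Sup.

(* The v-reduced divisor of |D|. *)
Lemma exists_reduced D v : effective D -> exists2 D', linear_system D D' &
  forall f, sections D' f -> forall x, f x <= f v.
Proof.
move=> eD; have [F [[gF DF] Fv Fmax]] := exists_max_section v eD.
have [D' DD' HD'] := sections_div (conj gF DF); exists D' => // f [gf Hf] x.
(* A section of [D'] added to [F] is one of [D]; normalized at [v], it competes with [F]. *)
pose g y := f y + F y + - f v.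
have gg : gpl g by apply: gplD; [exact: gplD | exact: gpl_cst].
have og y : ord g y = ord f y + ord F y.
  by rewrite ord_gplD ?ord_cst ?addr0 ?ord_gplD//; [exact: gplD | exact: gpl_cst].
have : g x <= F x; last by rewrite /g; lra.
apply: Fmax; last by rewrite /g Fv addr0 subrr.
by split=> // y; rewrite og [ord f y + _]addrC addrA -HD'.
Qed.

End MaximalSection.

(** * The component of a reduced divisor *)

Section Topology.
Context {R : realType} {G : metric_graph R}.
Implicit Types (e : mg_edge G) (t h l : R) (x y v : mg_point G) (D E : {freeg (mg_point G)}).
Implicit Types (f g : mg_point G -> R) (d : mg_edge G * bool) (m p q : int).

(** Makes points closed, hence [supp D] too. A vertex pulls back to half-lines on which [edge_pt e]
    is constant, or to nothing. *)
Lemma closed_edge_fiber e y : closed [set t | edge_pt e t = y].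
Proof.
case: y => [w|[[e' t'] te']].
  have -> : [set t | edge_pt e t = inl w] =
      (if mg_src e == w then [set t | t <= 0] else set0) `|`
      (if mg_tgt e == w then [set t | mg_len e <= t] else set0).
    apply/seteqP; split=> t /=.
      have [t0|t0] := leP t 0; first by rewrite edge_pt_src// => -[->]; rewrite eqxx; left.
      have [tl|tl] := leP (mg_len e) t; first by rewrite edge_pt_tgt// => -[->]; rewrite eqxx;
        right.
      by have /edge_ptE[y ->] : 0 < t < mg_len e by rewrite t0.
    by case=> []; case: eqP => //= <- H; [rewrite edge_pt_src | rewrite edge_pt_tgt].
  by apply: closedU; case: ifP => _; [exact: closed_le | exact: closed0 | exact: closed_ge |
    exact: closed0].
have [ee|ee] := eqVneq e' e.
  have -> : [set t | edge_pt e t = inr (exist _ (e', t') te')] = [set t | t = t'].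
    apply/seteqP; split=> t /=; rewrite -edge_pt_inr.
      by move=> /esym /(edge_pt_inj te')[].
    by move=> ->; rewrite ee.
  exact: closed_eq.
have -> : [set t | edge_pt e t = inr (exist _ (e', t') te')] = set0; last exact: closed0.
apply/seteqP; split=> t //=; rewrite -edge_pt_inr => /esym /(edge_pt_inj te')[eE _].
by move: eE ee => /= ->; rewrite eqxx.
Qed.

Lemma open_point_compl y : open (~` [set y]).
Proof.
have : graph_open (~` [set y]); last exact.
by move=> e; have := @closed_edge_fiber e y; rewrite -openC.
Qed.

Lemma open_suppC D : open (~` supp D).
Proof.
rewrite openC; have -> : supp D = [set` dom D].
  by apply/seteqP; split=> x /=; rewrite mem_dom.
apply: accessible_finite_set_closed.1; last exact: finite_seq.
move=> x y xy; exists (~` [set y]); split; first exact: open_point_compl.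
  by rewrite inE /=; apply/eqP.
by rewrite setCK inE.
Qed.

Lemma connected_edge_image e (I : set R) : is_interval I -> connected (edge_pt e @` I).
Proof.
move=> /connected_intervalP cI; apply: connected_continuous_connected => //.
exact/continuous_subspaceT/edge_pt_continuous.
Qed.

Lemma ray_continuous x d : continuous (ray x d).
Proof.
move=> h; apply: (@continuous_comp _ _ _ (fun h => edge_coord x d + (if d.2 then h else - h)));
  last exact: edge_pt_continuous.
by apply: cvgD; [exact: cvg_cst | case: (d.2); [exact: cvg_id | exact: cvgN cvg_id]].
Qed.

Lemma connected_ray_image x d (I : set R) : is_interval I -> connected (ray x d @` I).
Proof.
move=> /connected_intervalP cI; apply: connected_continuous_connected => //.
exact/continuous_subspaceT/ray_continuous.
Qed.

Lemma connected_component_absorb (T : topologicalType) (O B : set T) (x y : T) :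
  connected B -> B `<=` O -> B y -> connected_component O x y -> B `<=` connected_component O x.
Proof.
by move=> cB BO By /same_connected_component ->; exact: connected_component_max.
Qed.

(** Local connectedness, tested on edges: a ball of parameters mapped into [O] is an interval, so
    its image stays in one component. *)
Lemma open_component (O : set (mg_point G)) x : open O -> open (connected_component O x).
Proof.
move=> oO; have : graph_open (connected_component O x); last exact.
move=> e; rewrite openE => t /= Ct.
have oe : open (edge_pt e @^-1` O) by have : graph_open O by []; exact.
have /nbhs_ballP[r /= r0 Hr] : nbhs t (edge_pt e @^-1` O).
  by apply: open_nbhs_nbhs; split => //; exact: connected_component_sub Ct.
apply/nbhs_ballP; exists r => // s ts.
apply: (@connected_component_absorb _ O (edge_pt e @` ball t r) x (edge_pt e t)) => //.
- apply: connected_edge_image => a b; rewrite /ball/= => Ha Hb c /andP[ac cb].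
  by move: Ha Hb; rewrite !ltr_distlC => /andP[A1 A2] /andP[B1 B2]; apply/andP; split; lra.
- by move=> _ [u /Hr Hu <-].
- by exists t => //; exact: ballxx.
Qed.

Lemma germ0_near (phi : R -> R) t : germ phi t true 0 -> germ phi t false 0 ->
  \forall s \near t, phi s = phi t.
Proof.
move=> /near0P[a a0 Ha] /near0P[b b0 Hb].
apply/nbhs_ballP; exists (Num.min a b) => /=; first by rewrite lt_min a0.
move=> s; rewrite /ball/= lt_min => /andP[].
have [st|ts|->] := ltgtP s t => //.
  rewrite gtr0_norm ?subr_gt0// => _ sb; have := Hb (t - s).
  by rewrite subr_gt0 st (ltW sb) subKr mul0r addr0; exact.
rewrite distrC gtr0_norm ?subr_gt0// => sa _; have := Ha (s - t).
by rewrite subr_gt0 ts (ltW sa) [t + _]addrC subrK mul0r addr0; exact.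
Qed.

Lemma gpl_continuous f : gpl f -> continuous f.
Proof. by move=> /gpl_rational[]. Qed.

Section Reduced.
Variables (D : {freeg (mg_point G)}) (v : mg_point G).
Hypothesis redD : forall f, sections D f -> forall x, f x <= f v.

Let U := connected_component (~` supp D) v.

Let U_coeff y : U y -> coeff y D = 0.
Proof. by move=> /connected_component_sub /negP; rewrite negbK => /eqP. Qed.

Let U_slopes f y d : sections D f -> U y -> f y = f v -> outgoing y d -> dgerm f y d 0.
Proof.
move=> Df Uy fy yd.
have slope_le0 d' m : outgoing y d' -> dgerm f y d' m -> m <= 0.
  move=> yd' gm; rewrite -(ler_int R).
  have -> : 0%:~R = if d'.2 then 0 else - 0 :> R by rewrite oppr0 if_same.
  apply: germ_at_max gm; near=> h.
  by rewrite mul0r subr0 /= edge_pt_coord// fy; exact: redD.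
have := Df.2 y; rewrite (U_coeff Uy) add0r /ord (bigD1 _ yd) /=.
have [m gm ->] := gpl_slope Df.1 yd.
have m0 := slope_le0 _ _ yd gm.
have S0 : \sum_(d' | outgoing y d' && (d' != d)) slope f y d' <= 0.
  apply: sumr_le0 => d' /andP[yd' _]; have [m' gm' ->] := gpl_slope Df.1 yd'.
  by rewrite lerz0; exact: slope_le0 yd' gm'.
move=> H; have {H S0}m0' : 0 <= m by rewrite -(ler_int R); lra.
by have -> : 0 = m by apply/eqP; rewrite eq_le m0' m0.
Unshelve. all: by end_near. Qed.

Hypothesis vD : coeff v D = 0.

Let Uv : U v.
Proof. by apply: connected_component_refl; rewrite /supp /= vD eqxx. Qed.

(* On U a section is constant: where it takes its maximal value f v its slopes are
   nonpositive with a nonnegative sum. *)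
Lemma reduced_constant f : sections D f -> forall y, U y -> f y = f v.
Proof.
move=> Df; pose Z := U `&` [set y | f y = f v].
have oU : open U by apply: open_component; exact: open_suppC.
suff ZU : Z = U by move=> y; rewrite -ZU => -[].
(* [Z] is nonempty, open and closed in the connected set [U]. *)
apply: (@component_connected _ (~` supp D) v Z); first by exists v.
- exists Z; last by rewrite /Z setIA setIid.
  have : graph_open Z; last exact.
  move=> e; rewrite openE => t /= [Ut ft].
  have g0 b : germ (f \o edge_pt e) t b 0.
    have [[td E]|st] := edge_pt_dir e t b.
      by have := U_slopes Df Ut ft td; rewrite /dgerm /= E.
    by apply: filterS st => h /= ->; rewrite mul0r addr0.
  have Ue : \forall s \near t, U (edge_pt e s).
    have oe : open (edge_pt e @^-1` U) by have : graph_open U by []; exact.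
    by apply: open_nbhs_nbhs; split.
  by apply: filterS2 Ue (germ0_near (g0 true) (g0 false)) => s Us fs; split => //;
    exact: etrans fs ft.
- exists [set y | f y = f v] => //.
  have /continuous_closedP C := gpl_continuous Df.1.
  exact: (C [set f v] (@closed_eq _ (f v))).
Qed.

Lemma reduced_supp_system y : U y -> ~ supp_system D y.
Proof.
move=> Uy [E /linear_system_sections[f Df HE]].
rewrite /supp /= => /negP; apply; rewrite -(intr_eq0 R) HE (U_coeff Uy) add0r /ord big1// => d yd.
by rewrite (slope_dgerm yd (U_slopes Df Uy (reduced_constant Df Uy) yd)).
Qed.

End Reduced.

End Topology.

(** * Firing a closed set *)

Section Tents.
Context {R : realType}.
Variable eps : R.
Hypothesis eps0 : 0 < eps.
Implicit Types (c t h b : R) (s : seq R).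

Definition tent c t : R := Num.max 0 (eps - `|t - c|).

(** A maximum and not a sum: [eps] is not compared with the distances between centers, and
    overlapping tents must not rise above [eps]. *)
Fixpoint tents s t : R := if s is c :: s' then Num.max (tent c t) (tents s' t) else 0.

Lemma pl_tent c : pl (tent c).
Proof.
have pl_id : pl (fun t : R => t).
  move=> t d; exists (if d then 1 else -1); near=> h.
  by case: d; rewrite /= ?mulN1r ?mul1r// mulrNz mulN1r.
have pl_sub : pl (fun t => t - c) by apply: plD => //; exact: pl_cst.
rewrite (_ : tent c = fun t => Num.max 0 (eps + - Num.max (t - c) (- (t - c)))).
  apply: pl_max; first exact: pl_cst.
  apply: plD; first exact: pl_cst.
  by apply: plN; apply: pl_max => //; exact: plN.
by apply/funext => t; rewrite /tent maxrN.
Unshelve. all: by end_near. Qed.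

Lemma pl_tents s : pl (tents s).
Proof.
by elim: s => [|c s IH] /=; [exact: pl_cst | apply: pl_max => //; exact: pl_tent].
Qed.

Lemma tents_ge s c t : c \in s -> tent c t <= tents s t.
Proof.
elim: s => //= a s IH; rewrite inE le_max => /predU1P[->|/IH ->]; last by rewrite orbT.
by rewrite lexx.
Qed.

Lemma tents_ge0 s t : 0 <= tents s t.
Proof. by elim: s => //= c s IH; rewrite le_max IH orbT. Qed.

Lemma tents_attained s t : tents s t = 0 \/ exists2 c, c \in s & tents s t = tent c t.
Proof.
elim: s => [|c s IH] /=; first by left.
have [_|_] := leP (tent c t) (tents s t); last by right; exists c; rewrite ?mem_head.
by case: IH => [->|[a as_ ->]]; [left | right; exists a; rewrite // inE as_ orbT].
Qed.

Lemma tents_le s t b : 0 <= b -> (forall c, c \in s -> eps - `|t - c| <= b) -> tents s t <= b.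
Proof.
move=> b0 H; case: (tents_attained s t) => [->//|[c cs ->]].
by rewrite /tent ge_max b0 H.
Qed.

Lemma tents_eps s t : t \notin s -> tents s t < eps.
Proof.
move=> ts; case: (tents_attained s t) => [->//|[c cs ->]].
rewrite /tent gt_max eps0 ltrBlDr ltrDl normr_gt0 subr_eq0.
by apply: contraNneq ts => ->.
Qed.

(** A tent is convex away from its peak [c]. For [h] below the distance to [c] both [t + h] and
    [t - h] lie on the same side of [c], so the tent attaining the maximum at [t] alone gives the
    midpoint inequality. *)
Lemma tents_convex s t p q : t \notin s -> germ (tents s) t true p -> germ (tents s) t false q ->
  0 <= p + q.
Proof.
move=> ts gp gq.
have mid : \forall h \near (0 : R)^'+, tents s t + tents s t <= tents s (t + h) + tents s (t - h).
  case: (tents_attained s t) => [->|[c cs E]].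
    by near=> h; rewrite addr0 addr_ge0 ?tents_ge0.
  have tc : t != c by apply: contraNneq ts => ->.
  have tc0 : 0 < `|t - c| by rewrite normr_gt0 subr_eq0.
  near=> h; have /andP[h0 ht] : 0 < h < `|t - c| by near: h; exact: near0_lt.
  apply: le_trans (lerD (tents_ge (t + h) cs) (tents_ge (t - h) cs)); rewrite E /tent.
  have [|pos] := leP (eps - `|t - c|) 0; first by rewrite addr0 addr_ge0// le_max lexx.
  have H1 : eps - `|t + h - c| <= Num.max 0 (eps - `|t + h - c|) by rewrite le_max lexx orbT.
  have H2 : eps - `|t - h - c| <= Num.max 0 (eps - `|t - h - c|) by rewrite le_max lexx orbT.
  apply: le_trans (lerD H1 H2).
  have : `|t + h - c| + `|t - h - c| = `|t - c| + `|t - c|; last by lra.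
  move: ht; case: (ltgtP t c) tc => // tc _.
    rewrite (ltr0_norm (x := t - c)) ?subr_lt0// => ht.
    by rewrite !ltr0_norm; lra.
  rewrite (gtr0_norm (x := t - c)) ?subr_gt0// => ht.
  by rewrite !gtr0_norm; lra.
have [e e0 H] := (near0P _).1 (filterI mid (filterI gp gq)).
have [] := H e; first by rewrite e0 lexx.
move=> M [P Q]; rewrite /= in P Q; rewrite P Q in M.
by rewrite -(ler_int R) intrD -(ler_pM2r e0); lra.
Unshelve. all: by end_near. Qed.

End Tents.

Section Special.
Context {R : realType} {G : metric_graph R}.
Implicit Types (e : mg_edge G) (t h l : R) (x y v : mg_point G) (D E : {freeg (mg_point G)}).
Implicit Types (f g : mg_point G -> R) (d : mg_edge G * bool) (m p q : int).

(** An inner point of an edge determines edge and coordinate. Opposite directions from an interior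
    point move the coordinate to opposite sides; from a vertex they would make the edge a loop. *)
Lemma ray_inj x d d' h h' : outgoing x d -> outgoing x d' ->
  0 < h < room x d -> ray x d h = ray x d' h' -> 0 <= h' -> d = d' /\ h = h'.
Proof.
move=> xd xd' hr; rewrite /ray => /edge_pt_inj E h'0.
have [] := E; first by apply: shift_itv_lt => //; exact: edge_coord_itv.
have [dE|dE] := eqVneq d d'.
  by rewrite dE => _ /addrI; case: (d'.2) => [|/oppr_inj] ->.
have h0 : 0 < h by case/andP: hr.
move=> e12; have b12 : d.2 = ~~ d'.2.
  have : d.2 != d'.2.
    by apply: contra dE => /eqP b; rewrite [d]surjective_pairing e12 b -surjective_pairing.
  by case: (d.2) (d'.2) => -[].
case: x xd xd' hr E => [w|y] /=; last first.
  by move=> _ _ _ _ /addrI; rewrite b12; case: (d'.2) => /=; lra.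
rewrite b12 -e12 => /eqP s1 /eqP s2; have := mg_loopless d.1.
by case: (d'.2) s1 s2 => /= -> ->; rewrite eqxx.
Qed.

Lemma outdeg_ge2 (X : set (mg_point G)) x d d' l l' : outgoing x d -> outgoing x d' -> d != d' ->
  0 < l <= room x d -> 0 < l' <= room x d' ->
  (forall h, 0 < h < l -> ~ X (ray x d h)) -> (forall h, 0 < h < l' -> ~ X (ray x d' h)) ->
  (2%:E <= outdeg X x)%E.
Proof.
move=> xd xd' dd' /andP[l0 lr] /andP[l'0 lr'] HX HX'.
apply: ereal_sup_ubound; exists 2%N => //=.
(* Half of the ray, so that the far end stays inside the edge, where [ray_inj] gives injectivity. *)
pose seg d l (s : R) := ray x d (s * (l / 2)).
exists (fun i => if i == ord0 then seg d l else seg d' l').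
have segP b (k : R) : outgoing x b -> 0 < k <= room x b -> segment_from x (seg b k).
  move=> xb /andP[k0 kr]; split; last by rewrite /seg mul0r ray0.
    apply/continuous_subspaceT => s; rewrite /seg.
    apply: (@continuous_comp _ _ _ (fun s : R => s * (k / 2)) (ray x b) s);
      last exact: ray_continuous.
    by apply: cvgM; [exact: cvg_id | exact: cvg_cst].
  move=> s s'; rewrite !in_itv /= => /andP[s0 s1] /andP[s'0 s'1] E.
  have k20 : 0 < k / 2 by rewrite divr_gt0.
  have H r : r <= 1 -> r * (k / 2) < room x b.
    by move=> r1; apply: lt_le_trans kr; nra.
  have inj1 r r' : 0 < r <= 1 -> 0 <= r' -> seg b k r = seg b k r' -> r = r'.
    move=> /andP[r0 r1] r'0 Er.
    have [_ /(mulIf (lt0r_neq0 k20))->//] : b = b /\ r * (k / 2) = r' * (k / 2).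
    apply: (ray_inj xb xb _ Er); last exact: mulr_ge0 r'0 (ltW k20).
    by rewrite mulr_gt0//= H.
  move: s0 s'0; rewrite !le_eqVlt => /predU1P[sz|sz] /predU1P[sz'|sz'].
  - by rewrite -sz -sz'.
  - by apply/esym/inj1 => //; rewrite ?sz' // -sz.
  - by apply: inj1 => //; rewrite ?sz // -sz'.
  - by apply: inj1 => //; rewrite ?sz // ltW.
have segI (k s : R) : 0 < k -> s \in `]0, 1[%R -> 0 < s * (k / 2) < k.
  by rewrite in_itv /= => k0 /andP[s0 s1]; apply/andP; split; nra.
split.
- by move=> i; case: ifP => _; apply: segP => //; apply/andP.
- by move=> i _ [s /= s01 <-]; case: ifP => _; [apply: HX | apply: HX']; apply: segI.
have disj s s' : s \in `]0, 1[%R -> s' \in `]0, 1[%R -> seg d l s = seg d' l' s' -> False.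
  move=> /(segI l _ l0) /andP[a0 al] /(segI l' _ l'0) /andP[b0 bl] E.
  have [||dE _] := ray_inj xd xd' _ E; first by rewrite a0 (lt_le_trans al).
    exact: ltW.
  by rewrite dE eqxx in dd'.
move=> i j _ _ [_ [/= [s si <-] [s' sj]]].
have [i0|i0] := eqVneq i ord0; have [j0|j0] := eqVneq j ord0.
- by rewrite i0 j0.
- by move=> /esym E; case: (disj s s').
- by move=> E; case: (disj s' s).
- move=> _; apply: val_inj; move: i0 j0; rewrite -!val_eqE /=.
  by case: i j {si sj} => -[|[|?]] // + [[|[|?]] //].
Qed.

(** The open ray is connected and free of chips, so [U] contains all of it or none; [x] shares its
    fate unless it carries a chip. *)
Lemma ray_dichotomy D v x d l : outgoing x d -> free_ray D x d l ->
  let U := connected_component (~` supp D) v in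
  (forall h, 0 < h < l -> U (ray x d h)) /\ (~ U x -> coeff x D != 0) \/
  (forall h, 0 <= h < l -> ~ U (ray x d h)).
Proof.
move=> xd [/andP[l0 _] free] U.
have freeO h : 0 < h < l -> (~` supp D) (ray x d h).
  by move=> hl; rewrite /supp /= free// eqxx.
have abs : coeff x D = 0 -> forall h, 0 <= h < l -> U (ray x d h) ->
    forall h', 0 <= h' < l -> U (ray x d h').
  move=> x0 h hl Uh h' hl'.
  apply: (@connected_component_absorb _ _ (ray x d @` [set h | 0 <= h < l]) _ (ray x d h)) => //.
  - by apply: connected_ray_image => a b /= /andP[? ?] /andP[? ?] c /andP[? ?]; apply/andP;
    split; lra.
  - move=> _ [k /= /andP[k0 kl] <-]; move: k0; rewrite le_eqVlt => /predU1P[<-|k0].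
      by rewrite ray0// /supp /= x0 eqxx.
    by apply: freeO; rewrite k0.
have [[h hl Uh]|noU] := pselect (exists2 h, 0 < h < l & U (ray x d h)).
  left; split.
    move=> h' hl'.
    apply: (@connected_component_absorb _ _ (ray x d @` [set h | 0 < h < l]) _ (ray x d h)) => //.
    - by apply: connected_ray_image => a b /= /andP[? ?] /andP[? ?] c /andP[? ?]; apply/andP;
      split; lra.
    - by move=> _ [k /= kl <-]; exact: freeO.
  move=> Ux; apply/eqP => x0; apply: Ux; rewrite -(ray0 xd).
  case/andP: hl => h0 hl; apply: (abs x0 h) => //; first by rewrite hl ltW.
  by rewrite lexx.
right=> h hl Uh; apply: noU.
move: hl => /andP[]; rewrite le_eqVlt => /predU1P[h0 _|h0 hl]; last by exists h; rewrite ?h0.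
have l2 : 0 < l / 2 < l by apply/andP; split; lra.
rewrite -h0 (ray0 xd) in Uh.
exists (l / 2) => //; apply: (abs _ 0); rewrite ?lexx ?(ray0 xd)//;
  last by case/andP: l2 => /ltW -> ->.
by have := connected_component_sub Uh; rewrite /supp /= => /negP; rewrite negbK => /eqP.
Qed.

End Special.

Section Fire.
Context {R : realType} {G : metric_graph R}.
Implicit Types (e : mg_edge G) (t h l : R) (x y : mg_point G) (d : mg_edge G * bool) (m p q : int).
Variables (D : {freeg (mg_point G)}) (v x0 : mg_point G).
Hypotheses (eD : effective D) (vD : coeff v D = 0).
Hypothesis redD : forall f, sections D f -> forall x, f x <= f v.

Let U := connected_component (~` supp D) v.
Hypothesis Ux0 : ~ U x0.
Let X := connected_component (~` U) x0.
Hypothesis Xdeg : forall w, (X `&` boundary X) w -> ~ (2%:E <= outdeg X w)%E.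

Let XU x : X x -> ~ U x.
Proof. by move=> /connected_component_sub. Qed.

Let Xx0 : X x0.
Proof. exact: connected_component_refl. Qed.

Let Uv : U v.
Proof. by apply: connected_component_refl; rewrite /supp /= vD eqxx. Qed.

(** All chips in [X] are listed, even those not adjacent to [U]: on [X] itself [fire] disregards the
    tents. *)
Let centers e : seq R := [seq edge_coord i.1 i.2 |
  i <- [seq (y, d) | y <- dom D, d <- enum {: mg_edge G * bool}] &
       [&& `[< X i.1 >], outgoing i.1 i.2 & i.2.1 == e]].

Let mem_centers x d : X x -> coeff x D != 0 -> outgoing x d -> edge_coord x d \in centers d.1.
Proof.
move=> Xx xD xd; apply/mapP; exists (x, d) => //.
rewrite mem_filter /= asboolT//= xd eqxx /=.
by apply/allpairsP; exists (x, d); split=> //=; [rewrite mem_dom | rewrite mem_enum].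
Qed.

Let centersP e c : c \in centers e -> X (edge_pt e c) /\ 0 <= c <= mg_len e.
Proof.
case/mapP => -[y d]; rewrite mem_filter /= => /andP[/and3P[/asboolP Xy yd /eqP <-] _] ->.
by rewrite edge_pt_coord//; split=> //; exact: edge_coord_itv.
Qed.

(** Of the two [eps], one is the half-width of a tent and the other keeps a neighbourhood of each
    end of the edge flat, unless the center is that end. *)
Let exists_eps : exists2 eps : R, 0 < eps & forall e c, c \in centers e ->
  (0 < c -> 2 * eps <= c) /\ (c < mg_len e -> 2 * eps <= mg_len e - c).
Proof.
have [l /andP[l0 _] [_ lmin]] := @exists_min_pos R 1 (flatten
  [seq centers e ++ [seq mg_len e - c | c <- centers e] | e <- enum (mg_edge G)]) ltr01.
exists (l / 2); first by rewrite divr_gt0.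
move=> e c ce; rewrite mulrC divfK ?pnatr_eq0//; split=> H; apply: lmin; rewrite ?subr_gt0//.
  by apply/flatten_mapP; exists e; rewrite ?mem_enum// mem_cat ce.
by apply/flatten_mapP; exists e; rewrite ?mem_enum// mem_cat (map_f (fun c =>
  mg_len e - c) ce) orbT.
Qed.

Section WithEps.
Variable eps : R.
Hypothesis eps0 : 0 < eps.
Hypothesis eps_le : forall e c, c \in centers e ->
  (0 < c -> 2 * eps <= c) /\ (c < mg_len e -> 2 * eps <= mg_len e - c).

(* Each point of X in supp D sends chips at distance eps along the edges leaving
   X; eps is too small for them to meet a vertex. *)
Let fire x : R := if `[< X x >] then eps else
  if x is inr y then tents eps (centers (sval y).1) (sval y).2 else 0.

Let fireX x : X x -> fire x = eps.
Proof. by move=> Xx; rewrite /fire asboolT. Qed.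

Let fire_tents e t : 0 < t < mg_len e -> ~ X (edge_pt e t) ->
  fire (edge_pt e t) = tents eps (centers e) t.
Proof.
by move=> /edge_ptE[y yE Ey] nX; rewrite /fire asboolF// yE Ey.
Qed.

(** A ray that misses [U] is connected in the complement of [U], so the component [X] contains all
    of it or none. *)
Let ray_cases x d : outgoing x d -> exists2 l, 0 < l <= room x d &
  (forall h, 0 < h < l -> U (ray x d h)) /\ (~ U x -> coeff x D != 0) \/
  (forall h, 0 <= h < l -> (X (ray x d h) <-> X x)).
Proof.
move=> xd; have [l fr _] := exists_free_ray D xd; exists l; first exact: fr.1.
case: (ray_dichotomy v xd fr) => [|nU]; [by left | right=> h hl].
have [/andP[l0 _] _] := fr.
have abs a b : 0 <= a < l -> 0 <= b < l -> X (ray x d a) -> X (ray x d b).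
  move=> al bl Xa.
  apply: (@connected_component_absorb _ _ (ray x d @` [set h | 0 <= h < l]) _ (ray x d a)) => //.
  - by apply: connected_ray_image => c1 c2 /= /andP[? ?] /andP[? ?] c /andP[? ?]; apply/andP;
    split; lra.
  - by move=> _ [k /= kl <-]; exact: nU.
have z0 : 0 <= (0 : R) < l by rewrite lexx.
by split=> H; [rewrite -(ray0 xd); exact: abs H | apply: (abs 0); rewrite ?(ray0 xd)].
Qed.

Let leaves x d := exists2 l, 0 < l <= room x d & forall h, 0 < h < l -> ~ X (ray x d h).

Let ray_interior x d h : outgoing x d -> 0 < h < room x d ->
  0 < edge_coord x d + (if d.2 then h else - h) < mg_len d.1.
Proof. by move=> xd hr; apply: shift_itv_lt => //; exact: edge_coord_itv. Qed.

Let fire_germX x d : X x -> outgoing x d ->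
  dgerm fire x d 0 \/ [/\ dgerm fire x d (-1), leaves x d & coeff x D != 0].
Proof.
move=> Xx xd; have [l /andP[l0 lr] [[Ul xD]|HX]] := ray_cases xd; [right | left].
  have nX h : 0 < h < l -> ~ X (ray x d h) by move=> /Ul Uh /XU.
  split; [|by exists l; rewrite ?l0|exact: xD (XU Xx)].
  apply/(dgermP fire (-1) xd); near=> h.
  have /andP[h0 hl] : 0 < h < l / 2 by near: h; apply: near0_lt; rewrite divr_gt0.
  have /andP[_ he] : 0 < h < eps by near: h; exact: near0_lt.
  have hl' : h < l by lra.
  rewrite (fireX Xx) /ray fire_tents; last 2 first.
  - by apply: ray_interior => //; rewrite h0 (lt_le_trans hl').
  - by apply: nX; rewrite h0.
  have xc := mem_centers Xx (xD (XU Xx)) xd.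
  rewrite mulrNz mulN1r; apply/eqP; rewrite eq_le; apply/andP; split; last first.
    apply: le_trans (tents_ge eps _ xc); rewrite /tent le_max [_ - edge_coord x d]addrAC subrr
      add0r.
    by case: (d.2); rewrite ?normrN (gtr0_norm h0) lexx orbT.
  apply: tents_le; first by rewrite subr_ge0 ltW.
  (* A center closer than [h] to the point would lie ahead of [x] at a distance [k < 2 * h < l], in
     a part of the ray outside [X]. So the tent at [x] decides. *)
  move=> c /centersP[Xc _]; rewrite lerD2l lerN2 leNgt; apply/negP => ch.
  set k := if d.2 then c - edge_coord x d else edge_coord x d - c.
  have kl : 0 < k < l.
    move: ch; rewrite /k ltr_norml => /andP[]; case: (d.2) => ? ?; apply/andP; split; lra.
  apply: (nX k kl); rewrite /ray /k; case: (d.2); first by rewrite addrC subrK.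
  by rewrite subKr.
apply/(dgermP fire 0 xd); near=> h.
rewrite mul0r addr0 !fireX//; apply/HX => //.
by have /andP[/ltW -> ->] : 0 < h < l by near: h; exact: near0_lt.
Unshelve. all: by end_near. Qed.

Let nX_near x d : ~ X x -> outgoing x d -> \forall h \near (0 : R)^'+, ~ X (ray x d h).
Proof.
move=> nX xd; have [l /andP[l0 lr] H] := ray_cases xd.
near=> h; have /andP[h0 hl] : 0 < h < l by near: h; exact: near0_lt.
case: H => [[Ul _] /XU|HX]; first by apply; apply: Ul; rewrite h0.
by move=> /HX; rewrite ltW// hl => /(_ isT).
Unshelve. all: by end_near. Qed.

Let fire_germ_vertex w d : ~ X (inl w) -> outgoing (inl w) d -> dgerm fire (inl w) d 0.
Proof.
move=> nX xd; have nXh := nX_near nX xd.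
have [/andP[r0 _]] : 0 < room (inl w) d <= mg_len d.1 by exact: edge_coord_room.
apply/(dgermP fire 0 xd); near=> h.
rewrite mul0r addr0 {2}/fire asboolF//.
have hr : 0 < h < room (inl w) d by near: h; exact: near0_lt.
have /andP[h0 he] : 0 < h < eps by near: h; exact: near0_lt.
rewrite /ray fire_tents; [|exact: ray_interior|by near: h].
apply/eqP; rewrite eq_le tents_ge0 andbT; apply: tents_le => // c ce.
have [Xc /andP[c0 cl]] := centersP ce; have [e1 e2] := eps_le ce.
have cx : c != edge_coord (inl w) d.
  by apply: contra_notN nX => /eqP E; rewrite -(edge_pt_coord xd) -E.
rewrite subr_le0; move: cx hr; rewrite /room /=; case: (d.2) => cx hr.
  have c1 : 0 < c by rewrite lt_neqAle eq_sym cx.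
  have := e1 c1; rewrite add0r distrC ger0_norm; lra.
have c1 : c < mg_len d.1 by rewrite lt_neqAle cx.
have := e2 c1; rewrite ger0_norm; lra.
Unshelve. all: by end_near. Qed.

Let fire_germ_interior e t (b : bool) m : 0 < t < mg_len e -> ~ X (edge_pt e t) ->
  germ (tents eps (centers e)) t b m -> dgerm fire (edge_pt e t) (e, b) m.
Proof.
move=> te nX gm; have /andP[t0 tl] := te.
have [xd E] : outgoing (edge_pt e t) (e, b) /\ edge_coord (edge_pt e t) (e, b) = t.
  by apply: edge_pt_out; case: b {gm}; rewrite ?t0 ?tl ltW.
have nXh := nX_near nX xd.
have [/andP[r0 _]] : 0 < room (edge_pt e t) (e, b) <= mg_len e by exact: edge_coord_room xd.
apply/(dgermP fire m xd); near=> h.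
have hr : 0 < h < room (edge_pt e t) (e, b) by near: h; exact: near0_lt.
have := ray_interior xd hr; have : ~ X (ray (edge_pt e t) (e, b) h) by near: h.
rewrite /ray E /= => nXr ti.
by rewrite !fire_tents//; near: h.
Unshelve. all: by end_near. Qed.

Let fire_gpl : gpl fire.
Proof.
apply: gpl_out => x d xd; have [Xx|nX] := pselect (X x).
  by have [g|[g _ _]] := fire_germX Xx xd; [exists 0 | exists (-1)].
case: x xd nX => [w|y] xd nX; first by exists 0; exact: fire_germ_vertex.
case: y xd nX => -[e t] te; case: d => e' b /= /eqP <-; rewrite -edge_pt_inr => nX.
have [m gm] := pl_tents eps (centers e) t b.
by exists m; exact: fire_germ_interior.
Qed.

Let leaves_boundary x d : X x -> outgoing x d -> leaves x d -> boundary X x.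
Proof.
move=> Xx xd [l /andP[l0 _] nX]; split; first exact: subset_closure.
move=> iX.
have C : ray x d h @[h --> (0 : R)] --> ray x d 0 by exact: ray_continuous.
rewrite (ray0 xd) in C; have /nbhs_ballP[r /= r0 Hr] := C _ iX.
pose h := Num.min r l / 2.
have m0 : 0 < Num.min r l by rewrite lt_min r0.
have mr : Num.min r l <= r by rewrite ge_min lexx.
have ml : Num.min r l <= l by rewrite ge_min lexx orbT.
have h0 : 0 < h by rewrite divr_gt0.
have hm : h < Num.min r l by rewrite /h; lra.
apply: (nX h); first by rewrite h0 (lt_le_trans hm).
by apply: Hr; rewrite /ball/= sub0r normrN gtr0_norm// (lt_le_trans hm).
Qed.

(** The point where small outdegrees enter: two leaving directions would yield two disjoint segments
    outside [X]. *)
Let leaves_uniq x d d' : X x -> outgoing x d -> outgoing x d' -> leaves x d -> leaves x d' ->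
  d = d'.
Proof.
move=> Xx xd xd' lv lv'; apply/eqP; apply: contra_notT (Xdeg (w := x) _) => [dd'|]; last first.
  by split=> //; exact: leaves_boundary lv.
case: lv lv' => [l lr nX] [l' lr' nX'].
exact: (outdeg_ge2 xd xd' dd' lr lr').
Qed.

(** In [X] the only negative slope possible is a single [-1], at a point with a chip to pay for it.
    Off [X], [fire] is flat at vertices and convex inside edges, all peaks being in [X]. *)
Let fire_sections : sections D fire.
Proof.
split=> // x; have Dx : (0 : R) <= (coeff x D)%:~R by rewrite ler0z.
have [Xx|nX] := pselect (X x).
  have [[d xd [g lv xD]]|nl] := pselect (exists2 d, outgoing x d &
      [/\ dgerm fire x d (-1), leaves x d & coeff x D != 0]).
    rewrite /ord (bigD1 _ xd) /= (slope_dgerm xd g) big1 ?addr0.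
      have : 1 <= coeff x D by rewrite -gtz0_ge1 lt_neqAle eq_sym xD eD.
      by rewrite -(ler_int R) mulrNz; lra.
    move=> d' /andP[xd' dd']; case: (fire_germX Xx xd') => [/(slope_dgerm xd')->//|[_ lv' _]].
    by rewrite (leaves_uniq Xx xd' xd lv' lv) eqxx in dd'.
  rewrite /ord big1 ?addr0// => d xd.
  case: (fire_germX Xx xd) => [/(slope_dgerm xd)->//|H].
  by case: nl; exists d.
case: x nX Dx => [w|[[e t] te]] nX Dx.
  by rewrite /ord big1 ?addr0// => d xd; rewrite (slope_dgerm xd (fire_germ_vertex nX xd)).
move: nX Dx; rewrite -edge_pt_inr => nX Dx; rewrite ord_interior//.
have ts : t \notin centers e by apply: contra_notN nX => /centersP[].
have [p gp] := pl_tents eps (centers e) t true.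
have [q gq] := pl_tents eps (centers e) t false.
have /andP[t0 tl] := te.
have [xd1 _] := @edge_pt_out R G e t true ltac:(by rewrite tl ltW).
have [xd2 _] := @edge_pt_out R G e t false ltac:(by rewrite t0 ltW).
rewrite (slope_dgerm xd1 (fire_germ_interior te nX gp)) (slope_dgerm xd2 (fire_germ_interior te
  nX gq)).
by rewrite addr_ge0// -intrD ler0z; exact: (tents_convex ts gp gq).
Qed.

Lemma fire_absurd : False.
Proof.
have := redD fire_sections x0; rewrite (fireX Xx0) leNgt => /negP; apply.
have nXv : ~ X v by move=> /XU.
rewrite /fire asboolF//; case v_eq : v => [w|[[e t] te]]//=.
apply: tents_eps => //; apply: contra_notN nXv => /centersP[+ _].
by rewrite v_eq edge_pt_inr.
Qed.

End WithEps.

Lemma reduced_small_outdeg_absurd : False.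
Proof. by have [eps eps0 eps_le] := exists_eps; exact: (fire_absurd eps0 eps_le). Qed.

End Fire.

(** * From special open sets to ranks *)

Section Main.
Context {R : realType} {G : metric_graph R}.
Implicit Types (x y v : mg_point G) (D E : {freeg (mg_point G)}) (A : set (mg_point G)).

Lemma special_open_reduced D v : effective D -> coeff v D = 0 ->
  (forall f, sections D f -> forall x, f x <= f v) ->
  special_open (connected_component (~` supp D) v).
Proof.
move=> eD vD redD; split.
- by apply: open_component; exact: open_suppC.
- exact: component_connected.
(* This alternative also serves when [U] is the whole graph, where it is vacuous. *)
apply: Or33 => x0 Ux0; apply: contrapT => no.
apply: (reduced_small_outdeg_absurd eD vD redD Ux0) => w Xw dw.
by apply: no; exists w.
Qed.

Lemma closureL_of_special A v : A !=set0 ->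
  (forall U : set (mg_point G), special_open U -> U v -> A `&` U !=set0) -> closureL A v.
Proof.
move=> [a Aa] H D AD; apply: contrapT => nv.
(* [D] need not be effective; a point of [A] supplies an effective member of its linear system to be
   reduced. *)
have [D0 DD0 _] := AD a Aa; have [E ED0 redE] := exists_reduced v DD0.1.
have DE : linear_system D = linear_system E.
  by rewrite -(linear_system_equiv DD0.2); apply/esym/linear_system_equiv; exact: ED0.2.
have DEs : supp_system D = supp_system E by rewrite /supp_system DE.
have vE : coeff v E = 0.
  apply/eqP; apply: contra_notT nv => vE; rewrite DEs; exists E => //.
  by split; [exact: ED0.1 | exact: lin_equiv_refl].
have [|b [Ab Ub]] := H _ (special_open_reduced ED0.1 vE redE).
  by apply: connected_component_refl; rewrite /supp /= vE eqxx.
by apply: (reduced_supp_system redE vE Ub); rewrite -DEs; exact: AD.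
Qed.

(** The bridge between ranks and supports: an effective divisor stays effective after losing a chip
    at [x] exactly when it has one there. *)
Lemma linear_system_subU D x : (linear_system (D - <<x>>) !=set0) <-> supp_system D x.
Proof.
split=> [[E [eE ED]]|[E [eE ED] xE]].
  exists (E + <<x>>).
    split=> [y|]; first by rewrite coeffD coeffU addr_ge0// mul1r.
    by case: ED => f F H; exists f => // y; rewrite -H opprB addrA addrAC.
  by rewrite /supp /= coeffD coeffU eqxx mulr1 gt_eqF// ltr_wpDl//; exact: eE.
exists (E - <<x>>); split=> [y|].
  rewrite coeffB coeffU mul1r subr_ge0; case: eqP => [<-|_]; last exact: eE.
  by rewrite -gtz0_ge1 lt_neqAle eq_sym xE eE.
by case: ED => f F H; exists f => // y; rewrite -H opprB addrA subrK.
Qed.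

(** Effective divisors as lists with repetition, for an induction that exchanges one point at a
    time. *)
Definition point_sum (s : seq (mg_point G)) : {freeg (mg_point G)} := \sum_(x <- s) <<x>>.

Lemma coeff_point_sum s y : coeff y (point_sum s) = (count_mem y s)%:Z.
Proof.
elim: s => [|x s IH]; first by rewrite /point_sum big_nil coeff0.
rewrite /point_sum big_cons coeffD -/(point_sum s) IH coeffU mul1r /= PoszD.
by case: (x == y).
Qed.

Lemma deg_point_sum s : deg (point_sum s) = (size s)%:Z.
Proof.
elim: s => [|x s IH]; first by rewrite /point_sum big_nil deg0.
by rewrite /point_sum big_cons degD degU -/(point_sum s) IH.
Qed.

Lemma effective_point_sum E : effective E -> exists s, E = point_sum s.
Proof.
move=> eE; exists (flatten [seq nseq (absz (coeff z E)) z | z <- dom E]).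
apply/eqP/freeg_eqP => y; rewrite coeff_point_sum count_flatten -map_comp sumnE big_map.
rewrite (eq_bigr (fun z => if z == y then absz (coeff y E) else 0%N)); last first.
  by move=> z _ /=; rewrite count_nseq /=; case: eqP => [->|]; rewrite ?mul1n.
have [yE|yE] := boolP (y \in dom E).
  rewrite (bigD1_seq y) ?uniq_dom//= eqxx big1 ?addn0 ?gez0_abs//.
  by move=> z /negbTE ->.
rewrite (coeff_outdom yE) big_seq big1// => z zE.
by case: eqP => // zy; rewrite -zy zE in yE.
Qed.

(** In [K] the points of [r1] already lie in [A]. For [x] in [r2], [closureL A x] applied to [D]
    minus the other points allows [x] to be replaced by an arbitrary [a] in [A], which joins [r1];
    the degree stays [s]. *)
Lemma linear_system_points A D (s : nat) : (forall v, closureL A v) ->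
  (forall E, effective E -> deg E = s%:Z -> supp E `<=` A -> linear_system (D - E) !=set0) ->
  forall E, effective E -> deg E = s%:Z -> linear_system (D - E) !=set0.
Proof.
move=> LA H E /effective_point_sum[r ->]; rewrite deg_point_sum => -[rs].
suff K r2 r1 : (forall x, x \in r1 -> A x) -> (size r1 + size r2 = s)%N ->
    linear_system (D - point_sum (r1 ++ r2)) !=set0 by exact: (K r [::]).
elim: r2 r1 => [|x r2 IH] r1 r1A szE.
  rewrite cats0; apply: H.
  - by move=> y; rewrite coeff_point_sum.
  - by rewrite deg_point_sum -szE addn0.
  - move=> y; rewrite /supp /= coeff_point_sum => yr; apply: r1A.
    by rewrite -has_pred1 has_count lt0n.
have step a : point_sum (r1 ++ a :: r2) = point_sum (r1 ++ r2) + <<a>>.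
  by rewrite /point_sum !big_cat big_cons /= addrCA addrC.
rewrite step opprD addrA; apply/linear_system_subU; apply: LA => a Aa.
apply/linear_system_subU; rewrite -addrA -opprD -step.
have -> : point_sum (r1 ++ a :: r2) = point_sum ((a :: r1) ++ r2).
  by rewrite step /point_sum /= big_cons addrC.
apply: IH; last by rewrite -szE /= addnS.
by move=> y; rewrite inE => /predU1P[->|/r1A].
Qed.

Lemma rank_determining_closureL A : (forall v, closureL A v) -> rank_determining A.
Proof.
move=> LA D; rewrite /rank /rank_on; case: asboolP => // _; congr (ereal_sup [set _ | _ in _]).
apply/seteqP; split=> s /= H E eE dE; last by move=> _; exact: linear_system_points LA H _ eE dE.
by move=> _; exact: H.
Qed.

End Main.

Theorem theorem3p8 (R : realType) (G : metric_graph R) (v : mg_point G)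
    (A : set (mg_point G)) (A_neq0 : A !=set0) :
  [/\ (forall U : set (mg_point G),
         special_open U -> U v -> A `&` U !=set0) -> closureL A v,
      \bigcap_(U in [set U : set (mg_point G) |
                      special_open U /\ U `&` A = set0]) (~` U)
        `<=` closureL A &
      (forall U : set (mg_point G),
         special_open U -> U !=set0 -> U `&` A !=set0) ->
      rank_determining A].
Proof.
split.
- exact: closureL_of_special.
(* A special open set around [w] that missed [A] would be among those whose complements contain
   [w]. *)
- move=> w wU; apply: closureL_of_special => // U sU Uw; apply: contrapT => AU.
  apply: (wU U) => //; split=> //; rewrite setIC.
  by apply: contrapT => /eqP/set0P.
- move=> sA; apply: rank_determining_closureL => w; apply: closureL_of_special => // U sU Uw.
  by rewrite setIC; apply: sA => //; exists w.
Qed.
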